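(* Let $d\ge1$ and $S_X=[0,1]^d$, fix $x\in S_X$ with $f_X(x)>0$, and for $n\ge1$ let $N=N(n)=\lfloor d\log(n)/\{(d+2)\log(2)\}\rfloor$. Let $\mathcal V$ be the local map obtained from $N$ steps of a centered random tree independent of the data. Assume that the noise $\epsilon=Y-g(X)$ is sub-Gaussian conditionally on $X$ with parameter $\sigma^2$, that the minimal mass assumption holds with constant $\kappa>0$ and density $f_X$, and that $g$ is Lipschitz on $S_X$. Then there exists $C>0$, depending only on the parameters of the problem but not on $n$, such that with probability $1$ there is $N_0$ such that for all $n\ge N_0$, $$|\hat g_{\mathcal V}(x)-g(x)|\ \le\ C\,n^{-1/(d+2)}\,e^{2\sqrt{\log(n)\log\log(n)}}.$$
   Context: Regression model: $(X,Y)$ is a random vector, $X$ takes values in $S_X=[0,1]^d$, $Y$ is real valued, $g(x)=\mathbb E[Y\mid X=x]$, $\epsilon=Y-g(X)$; $(X_i,Y_i)_{i\ge1}$ are i.i.d. copies of $(X,Y)$. Conditionally sub-Gaussian with parameter $\sigma^2$: $\mathbb E[\epsilon\mid X]=0$ and $\mathbb E[\exp(t\epsilon)\mid X]\le \exp(\sigma^2t^2/2)$ for all $t\in\mathbb R$. Centered random tree around $x$: let $(D_i)_{i\ge1}$ be i.i.d. uniformly distributed on $\{1,\dots,d\}$, independent of the data. Start from the cell $[0,1]^d$. At step $i$, the side of the current cell in direction $D_i$ is cut at its midpoint, producing two new cells, and the one containing $x$ becomes the current cell. $\mathcal V(x)$ is the cell containing $x$ after $N$ steps; the same sequence $(D_i)_{i\ge1}$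 (the same growing tree) is used for all $n$. The estimator is $\hat g_{\mathcal V}(x)=\frac{\sum_{i=1}^nY_i\mathbf 1_{\mathcal V(x)}(X_i)}{\sum_{i=1}^n\mathbf 1_{\mathcal V(x)}(X_i)}$, with $0/0=0$. Minimal mass assumption: there are $\kappa>0$ and a density function $f_X$ (the density of $X$), not depending on $n$, such that, almost surely, for all $x\in S_X$ and every number of steps, the law of $X$ evaluated at the realized cell $\mathcal V(x)$ is at least $\kappa f_X(x)\lambda(\mathcal V(x))$, with $\lambda$ Lebesgue measure. The ''parameters of the problem'' are $d$, $\sigma^2$, $\kappa$, $f_X(x)$ and the Lipschitz constant of $g$. *)

(* Defs.v *)
(* Points of R^d are d-tuples of reals, whose measurable
   structure is the product (Borel) sigma-algebra. Sequences are 0-based. *)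
From HB Require Import structures.
From mathcomp Require Import all_boot all_order all_algebra finmap.
From mathcomp Require Import all_classical all_reals all_analysis.

Set Implicit Arguments.
Unset Strict Implicit.
Unset Printing Implicit Defensive.

Import Order.TTheory GRing.Theory Num.Theory.
Import numFieldNormedType.Exports.

Local Open Scope classical_set_scope.
Local Open Scope ring_scope.

Lemma sigma_finite_product d1 d2 (T1 : measurableType d1)
    (T2 : measurableType d2) (R : realType)
    (m1 : {sigma_finite_measure set T1 -> \bar R})
    (m2 : {sigma_finite_measure set T2 -> \bar R}) :
  sigma_finite setT (m1 \x m2)%E.
Proof.
have /sigma_finiteP[F [TF ndF Foo]] := sigma_finiteT m1.
have /sigma_finiteP[G [TG ndG Goo]] := sigma_finiteT m2.
exists (fun n => F n `*` G n).
  rewrite -setXTT TF TG predeqE => -[x y]; split.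
    move=> [/= [n _ Fnx] [k _ Gky]]; exists (maxn n k) => //; split.
    - by move: x Fnx; exact/subsetPset/ndF/leq_maxl.
    - by move: y Gky; exact/subsetPset/ndG/leq_maxr.
  by move=> [n _ []/= ? ?]; split; exists n.
move=> k; have [? ?] := Foo k; have [? ?] := Goo k.
split; first exact: measurableX.
by rewrite product_measure1E// lte_mul_pinfty// ge0_fin_numE.
Qed.

Section lebesgue_measure_tuple.
Variable R : realType.

(* [measurableTypeR R] is [R] with the display on which [lebesgue_measure] is
   declared; its measurable sets are those of [R]. *)
Definition pcons n (p : measurableTypeR R * n.-tuple R) : n.+1.-tuple R :=
  [tuple of (p.1 : R) :: p.2].

Fixpoint lebesgue_tuple (n : nat) : set (n.-tuple R) -> \bar R :=
  match n with
  | 0 => \d_([tuple])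
  | m.+1 => pushforward (lebesgue_measure \x @lebesgue_tuple m)%E (@pcons m)
  end.

Lemma measurable_pcons n : measurable_fun [set: measurableTypeR R * n.-tuple R] (@pcons n).
Proof.
exact: measurable_cons.
Qed.

Definition uncons n (t : n.+1.-tuple R) : measurableTypeR R * n.-tuple R :=
  (thead t, [tuple of behead t]).

Lemma measurable_uncons n : measurable_fun [set: n.+1.-tuple R] (@uncons n).
Proof.
apply/measurable_fun_pairP; split => /=; rewrite ?/comp /=.
- by move=> _ B mB; exact: (@measurable_tnth _ R n.+1 ord0).
- exact: measurable_behead.
Qed.

Lemma pconsK n : cancel (@pcons n) (@uncons n).
Proof.
by move=> [a t]; rewrite /uncons theadE; congr (_, _); exact/val_inj.
Qed.

Section pack.
Context d (T : measurableType d) (nu : set T -> \bar R).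
Hypotheses (nu0 : nu set0 = 0%E) (nu_ge0 : forall A, (0 <= nu A)%E)
  (nu_additive : semi_sigma_additive nu) (nu_finite : sigma_finite setT nu).

Let nu_isMeasure := isMeasure.Build _ _ _ nu nu0 nu_ge0 nu_additive.
Let nu_measure : {measure set T -> \bar R} := HB.pack nu nu_isMeasure.
Let nu_isSigmaFinite := Measure_isSigmaFinite.Build _ _ _ nu_measure nu_finite.
Let nu_sigma_finite : {sigma_finite_measure set T -> \bar R} :=
  HB.pack nu nu_isMeasure nu_isSigmaFinite.

Lemma pack_sigma_finite :
  exists mu : {sigma_finite_measure set T -> \bar R},
    mu = nu :> (set T -> \bar R).
Proof. by exists nu_sigma_finite. Qed.

End pack.

Lemma sigma_finite_pushforward_pcons n
    (mu : {sigma_finite_measure set (n.-tuple R) -> \bar R}) :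
  exists mu' : {sigma_finite_measure set (n.+1.-tuple R) -> \bar R},
    mu' = pushforward (lebesgue_measure \x mu)%E (@pcons n)
      :> (set (n.+1.-tuple R) -> \bar R).
Proof.
apply: pack_sigma_finite.
- by rewrite /pushforward preimage_set0 measure0.
- by move=> A; rewrite /pushforward; exact: measure_ge0.
- move=> F mF tF mUF; rewrite /pushforward preimage_bigcup.
  apply: measure_semi_sigma_additive.
  + by move=> i; rewrite -[X in measurable X]setTI; exact: measurable_pcons.
  + apply/trivIsetP => /= i j _ _ ij; rewrite -preimage_setI.
    by move/trivIsetP : tF => /(_ _ _ _ _ ij) ->//; rewrite preimage_set0.
  + rewrite -preimage_bigcup -[X in measurable X]setTI.
    exact: measurable_pcons.
- have [F UF mF] := sigma_finite_product (@lebesgue_measure R) mu.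
  exists (fun i => @uncons n @^-1` F i).
    by rewrite -preimage_bigcup -UF preimage_setT.
  move=> i; have [mFi Foo] := mF i; split.
    by rewrite -[X in measurable X]setTI; exact: measurable_uncons.
  rewrite /pushforward -comp_preimage (_ : @uncons n \o @pcons n = id) //.
  by apply/funext => p; exact: pconsK.
Qed.

Lemma lebesgue_tuple_is_measure n :
  exists mu : {sigma_finite_measure set (n.-tuple R) -> \bar R},
    mu = @lebesgue_tuple n :> (set (n.-tuple R) -> \bar R).
Proof.
elim: n => [|n [mu muE]].
  by exists [the {sigma_finite_measure set _ -> \bar R} of
    \d_([tuple] : 0.-tuple R)].
by have [nu nuE] := sigma_finite_pushforward_pcons mu; exists nu; rewrite nuE muE.
Qed.

Variable n : nat.

Let lebesgue_tuple0 : @lebesgue_tuple n set0 = 0%E.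
Proof. by have [mu <-] := lebesgue_tuple_is_measure n; exact: measure0. Qed.

Let lebesgue_tuple_ge0 A : (0 <= @lebesgue_tuple n A)%E.
Proof. by have [mu <-] := lebesgue_tuple_is_measure n; exact: measure_ge0. Qed.

Let lebesgue_tuple_sigma_additive : semi_sigma_additive (@lebesgue_tuple n).
Proof.
have [mu <-] := lebesgue_tuple_is_measure n.
exact: measure_semi_sigma_additive.
Qed.

HB.instance Definition _ := isMeasure.Build _ _ _ (@lebesgue_tuple n)
  lebesgue_tuple0 lebesgue_tuple_ge0 lebesgue_tuple_sigma_additive.

Let lebesgue_tuple_sigma_finite : sigma_finite setT (@lebesgue_tuple n).
Proof. by have [mu <-] := lebesgue_tuple_is_measure n; exact: sigma_finiteT. Qed.

HB.instance Definition _ := Measure_isSigmaFinite.Build _ _ _ (@lebesgue_tuple n)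
  lebesgue_tuple_sigma_finite.

End lebesgue_measure_tuple.

Arguments lebesgue_tuple {R n}.

Lemma lebesgue_tuple_box (R : realType) n (I : 'I_n -> set R) :
  (forall j, measurable (I j)) ->
  lebesgue_tuple [set t : n.-tuple R | forall j, I j (tnth t j)] =
  (\prod_(j < n) lebesgue_measure (I j))%E.
Proof.
elim: n I => [|n IHn] I mI.
  rewrite big_ord0 /= diracE mem_set //=.
  by case.
rewrite big_ord_recl -IHn //= /pushforward.
rewrite -product_measure1E //; last first.
  rewrite (_ : [set _ | _] = \bigcap_(j in [set: 'I_n])
    ((fun t : n.-tuple R => tnth t j) @^-1` I (lift ord0 j))); last first.
    by apply/seteqP; split => [t It j _|t It j]; exact: It.
  apply: fin_bigcap_measurable => // j _.
  by rewrite -[X in measurable X]setTI; exact: measurable_tnth.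
- exact: mI.
congr (product_measure1 _ _ _).
apply/seteqP; split => [[a t] /= It|[a t] /= [Ia It] j].
  split; first by have := It ord0; rewrite tnth0.
  by move=> j; have := It (lift ord0 j); rewrite tnthS.
by case: (unliftP ord0 j) => [k|] ->; rewrite ?tnthS ?tnth0.
Qed.

Section model.
Variable R : realType.

Section centered_tree.
Variable d : nat.

Definition unit_cube : set (d.-tuple R) :=
  [set y | forall j, 0 <= tnth y j <= 1].

(* A cut point belongs to the upper of the two new sides. *)
Definition cut_side (a : R) (side : interval R) : interval R :=
  let: Interval lo hi := side in
  let m := miditv side in
  if a < m then Interval lo (BLeft m) else Interval (BLeft m) hi.

(* The sides of the cell containing [x] after [N] steps along the directions
   [D 0, ..., D (N - 1)]. *)
Fixpoint tree_sides (D : nat -> 'I_d) (x : d.-tuple R) (N : nat)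
    : 'I_d -> interval R :=
  match N with
  | 0 => fun=> `[0, 1]
  | M.+1 => fun j => let side := tree_sides D x M j in
            if j == D M then cut_side (tnth x j) side else side
  end.

Definition tree_cell (D : nat -> 'I_d) (x : d.-tuple R) (N : nat)
    : set (d.-tuple R) :=
  [set y | forall j, tnth y j \in tree_sides D x N j].

Definition tree_steps (n : nat) : nat :=
  Num.truncn (d%:R * ln n%:R / ((d%:R + 2) * ln 2) : R).

(* The value is 0 when the cell contains no data point, since [0^-1 = 0]. *)
Definition local_average (V : set (d.-tuple R)) (Xs : nat -> d.-tuple R)
    (Ys : nat -> R) (n : nat) : R :=
  (\sum_(i < n) Ys i * \1_V (Xs i)) / (\sum_(i < n) \1_V (Xs i)).

Definition euclidean_lipschitz (A : set (d.-tuple R)) (L : R) (g : d.-tuple R -> R) :=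
  forall y z, A y -> A z ->
    `|g y - g z| <= L * Num.sqrt (\sum_(j < d) (tnth y j - tnth z j) ^+ 2).

End centered_tree.

Section probability.
Context (disp : measure_display) (Omega : measurableType disp)
  (P : probability Omega R).

(* Mutual independence of a sequence of sigma-algebras of events. *)
Definition mutually_independent (E : nat -> set (set Omega)) :=
  forall (J : {fset nat}) (A : nat -> set Omega),
    (forall i, i \in J -> E i (A i)) ->
    P (\bigcap_(i in [set` J]) A i) = (\prod_(i <- J) P (A i))%E.

Definition independent (E F : set (set Omega)) :=
  forall A B, E A -> F B -> P (A `&` B) = (P A * P B)%E.

Definition same_law d' (T' : measurableType d') (U V : Omega -> T') :=
  forall A, measurable A -> P (U @^-1` A) = P (V @^-1` A).

(* [W] is a version of the conditional expectation of [Z] given the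
   sub-sigma-algebra [G]. *)
Definition is_cond_exp (G : set (set Omega)) (Z W : Omega -> R) :=
  [/\ P.-integrable setT (EFin \o Z),
      P.-integrable setT (EFin \o W),
      forall B : set R, measurable B -> G (W @^-1` B) &
      forall A, G A -> (\int[P]_(w in A) (Z w)%:E = \int[P]_(w in A) (W w)%:E)%E].

Section regression.
Variables (d : nat) (X : {RV P >-> d.-tuple R}) (Y : {RV P >-> R}).

Definition is_regression (g : d.-tuple R -> R) :=
  is_cond_exp (g_sigma_algebra_preimage X) Y (g \o X).

(* The conditional moment generating function is bounded through one of its
   versions; versions agree almost surely. *)
Definition cond_sub_gaussian (sigma : R) (eps : Omega -> R) :=
  is_cond_exp (g_sigma_algebra_preimage X) eps (cst 0) /\
  forall t : R, exists M : Omega -> R,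
    is_cond_exp (g_sigma_algebra_preimage X) (fun w => expR (t * eps w)) M /\
    {ae P, forall w, M w <= expR (sigma ^+ 2 * t ^+ 2 / 2)}.

Definition is_density (f : d.-tuple R -> R) :=
  [/\ measurable_fun setT f, forall y, 0 <= f y &
      forall A, measurable A ->
        distribution P X A = (\int[lebesgue_tuple]_(y in A) (f y)%:E)%E].

Definition minimal_mass (D : nat -> Omega -> 'I_d) (kappa : R)
    (f : d.-tuple R -> R) :=
  is_density f /\
  {ae P, forall w, forall (y : d.-tuple R) (N : nat), unit_cube y ->
    let V := tree_cell (D ^~ w) y N in
    ((kappa * f y)%:E * lebesgue_tuple V <= distribution P X V)%E}.

Definition iid_copies (Xs : nat -> {RV P >-> d.-tuple R})
    (Ys : nat -> {RV P >-> R}) :=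
  mutually_independent
    (fun i => g_sigma_algebra_preimage (fun w => (Xs i w, Ys i w))) /\
  forall i, same_law (fun w => (Xs i w, Ys i w)) (fun w => (X w, Y w)).

End regression.

(* ['I_d] carries its discrete sigma-algebra. *)
Definition iid_uniform d (D : nat -> Omega -> 'I_d) :=
  [/\ forall i k, measurable (D i @^-1` [set k]),
      mutually_independent (fun i => preimage_set_system setT (D i) setT) &
      forall i k, P (D i @^-1` [set k]) = (d%:R^-1)%:E].

Definition independent_of_data d (D : nat -> Omega -> 'I_d)
    (Xs : nat -> {RV P >-> d.-tuple R}) (Ys : nat -> {RV P >-> R}) :=
  independent
    <<s \bigcup_i preimage_set_system setT (D i) setT >>
    <<s \bigcup_i g_sigma_algebra_preimage (fun w => (Xs i w, Ys i w)) >>.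

End probability.
End model.

(* Main.v *)
From HB Require Import structures.
Require Import Defs.
From mathcomp Require Import all_boot all_order all_algebra.
From mathcomp Require Import finmap ring lra.
From mathcomp Require Import all_classical all_reals all_analysis.
From mathcomp Require Import measurable_realfun.
Import Order.TTheory GRing.Theory Num.Theory.
Import numFieldNormedType.Exports HBSimple HBNNSimple.
Local Open Scope classical_set_scope.
Local Open Scope ring_scope.

Set Implicit Arguments.
Unset Strict Implicit.
Unset Printing Implicit Defensive.

(** The estimator averages the responses over the realized cell, so its error
splits into a bias, controlled by the diameter of the cell, and a noise term,
controlled by the number of data points that fall into it.

The noise is handled one direction sequence at a time. Once the first
[N = tree_steps R d n] directions are fixed, the cell [V] is a fixed set, and
it has volume [2 ^- N], which is at least of order [n ^ (- d / (d + 2))]. If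
[V] satisfies the mass inequality, then [q = P (X in V)] makes [n q] at least
of order [n ^ (2 / (d + 2))]. Writing [l = ln n], Chernoff bounds for the sums
of [1_V (X_i)] and of [1_V (X_i) (Y_i - g x)] show that, outside an event of
probability of order [expR (- (2 d + 2) l)], at least [n q / 4] points fall in
[V] and the error is at most [8 delta + 4 B sqrt (l / (n q))], where
[B = sigma ^ 2 + 2 d + 2] and [delta] bounds the oscillation of [g] on [V]
([cell_deviation], [tree_cell_deviation]). There are only [d ^ N <= expR (2 d l)] direction
sequences, so a union bound over all those with the mass inequality costs a
polynomial factor and leaves a summable probability ([tree_deviation]). The
realized sequence almost surely has the mass inequality at every depth, so by
Borel-Cantelli the bound eventually holds for the realized cell.

For the bias, the side of the cell in direction [j] is [2 ^- K] with [K] the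
number of cuts in that direction, a binomial variable of mean [N / d]. A
Chernoff bound and Borel-Cantelli over [N] give
[K > N / d - sqrt (8 (N / d) ln N)] eventually for all [j] ([tree_balanced]).
The leading term yields the factor [n ^ (- 1 / (d + 2))], and the deviation is
absorbed by [expR (2 sqrt (l ln l))] ([side_rate]); this same factor also
absorbs the [sqrt l] of the noise term ([sqrt_ln_le]).

The Chernoff bounds rest on the product formula for expectations of
independent variables ([expectation_prod_indep]). *)

(** * Expectation of a product of independent variables *)

(** Replacing indicators of [Z] by an arbitrary nonnegative function of [Z] is
the only limiting argument behind the product formula: the identity extends
from indicators to simple functions by linearity, and then to [h] by monotone
convergence. Finiteness of [c] makes multiplication by [c] continuous. *)
Lemma ge0_integral_weighted (R : realType) (disp : measure_display)
    (Omega : measurableType disp) (P : probability Omega R)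
    (W Z : Omega -> R) (c : \bar R) (h : R -> R) :
  measurable_fun setT W -> (forall w, 0 <= W w) ->
  measurable_fun setT Z -> c \is a fin_num ->
  (forall B, measurable B ->
    (\int[P]_w (W w * \1_B (Z w))%:E = c * \int[P]_w (\1_B (Z w))%:E)%E) ->
  measurable_fun setT h -> (forall z, 0 <= h z) ->
  (\int[P]_w (W w * h (Z w))%:E = c * \int[P]_w (h (Z w))%:E)%E.
Proof.
move=> mW W0 mZ cfin HB mh h0.
have mhE : measurable_fun setT (fun z => (h z)%:E) by exact/measurable_EFinP.
pose a := nnsfun_approx measurableT mhE.
have amon z : {homo (fun n => a n z) : n m / (n <= m)%N >-> n <= m}.
  by move=> n m nm; exact/lefP/nd_nnsfun_approx.
have acvg z : (a n z)%:E @[n --> \oo] --> (h z)%:E.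
  apply: (cvg_nnsfun_approx measurableT mhE) => // t _.
  by rewrite lee_fin.
have ma n : measurable_fun setT (a n \o Z) by exact: measurableT_comp.
have step n : (\int[P]_w (W w * a n (Z w))%:E
    = c * \int[P]_w (a n (Z w))%:E)%E.
  (* The absolute value keeps every term of the sum nonnegative, including
     those for values outside the range of [a n]. *)
  have aE z : a n z = \sum_(y \in range (a n)) `|y| * \1_(a n @^-1` [set y]) z.
    rewrite {1}(fimfunE (a n)); apply: eq_fsbigr => y; rewrite inE => -[t _ <-].
    by rewrite ger0_norm.
  have mB y : measurable (a n @^-1` [set y]) by exact: measurable_funPTI.
  have m1 y : measurable_fun setT (fun w => \1_(a n @^-1` [set y]) (Z w) : R).
    by apply: (measurableT_comp _ mZ); exact: measurable_indic.
  have fr : finite_set (range (a n)) by exact: fimfunP.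
  have -> : (\int[P]_w (W w * a n (Z w))%:E = \sum_(y \in range (a n))
      `|y|%:E * \int[P]_w (W w * \1_(a n @^-1` [set y]) (Z w))%:E)%E.
    transitivity (\sum_(y \in range (a n)) (\int[P]_w
        (`|y|%:E * (W w * \1_(a n @^-1` [set y]) (Z w))%:E)%E))%E; last first.
      apply: eq_fsbigr => y _; rewrite ge0_integralZl_EFin//.
      - by move=> w _; rewrite lee_fin mulr_ge0.
      - by apply/measurable_EFinP; exact: measurable_funM.
    rewrite -ge0_integral_fsum//; last 2 first.
    - move=> y; apply: emeasurable_funM => //; apply/measurable_EFinP.
      exact: measurable_funM.
    - by move=> y w _; rewrite -EFinM lee_fin !mulr_ge0.
    apply: eq_integral => w _; rewrite aE EFinM -fsumEFin// ge0_mule_fsumr.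
      apply: eq_fsbigr => y _; rewrite -!EFinM; congr EFin; ring.
    by move=> y; rewrite lee_fin ?mulr_ge0//; exact: integral_ge0.
  have -> : (\int[P]_w (a n (Z w))%:E = \sum_(y \in range (a n))
      `|y|%:E * \int[P]_w (\1_(a n @^-1` [set y]) (Z w))%:E)%E.
    transitivity (\sum_(y \in range (a n)) (\int[P]_w
        (`|y|%:E * (\1_(a n @^-1` [set y]) (Z w))%:E)%E))%E; last first.
      apply: eq_fsbigr => y _; rewrite ge0_integralZl_EFin//.
      exact/measurable_EFinP.
    rewrite -ge0_integral_fsum//; last first.
    - by move=> y; apply: emeasurable_funM => //; exact/measurable_EFinP.
    by apply: eq_integral => w _; rewrite aE -fsumEFin//.
  rewrite ge0_mule_fsumr; last first.
    by move=> y; rewrite mule_ge0 ?lee_fin//; exact: integral_ge0.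
  by apply: eq_fsbigr => y _; rewrite HB// muleCA.
have E1 : (\int[P]_w (W w * a n (Z w))%:E @[n --> \oo]
    --> \int[P]_w (W w * h (Z w))%:E)%E.
  have -> : (\int[P]_w (W w * h (Z w))%:E
     = \int[P]_w limn (fun n => (W w * a n (Z w))%:E))%E.
    apply: eq_integral => w _; apply/esym/cvg_lim => //.
    under eq_fun do rewrite EFinM.
    by rewrite EFinM; apply: cvgeZl => //; exact: acvg.
  apply: cvg_monotone_convergence => //.
  - by move=> n; apply/measurable_EFinP; apply: measurable_funM => //; exact: ma.
  - by move=> n w _; rewrite lee_fin mulr_ge0.
  - by move=> w _ n m nm; rewrite lee_fin ler_wpM2l// amon.
have E2 : (\int[P]_w (a n (Z w))%:E @[n --> \oo]
    --> \int[P]_w (h (Z w))%:E)%E.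
  have -> : (\int[P]_w (h (Z w))%:E
     = \int[P]_w limn (fun n => (a n (Z w))%:E))%E.
    by apply: eq_integral => w _; apply/esym/cvg_lim => //; exact: acvg.
  apply: cvg_monotone_convergence => //.
  - by move=> n; apply/measurable_EFinP; exact: ma.
  - by move=> n w _; rewrite lee_fin.
  - by move=> w _ n m nm; rewrite lee_fin amon.
have E3 : (c * \int[P]_w (a n (Z w))%:E @[n --> \oo]
    --> c * \int[P]_w (h (Z w))%:E)%E by exact: cvgeZl.
have E3' : (\int[P]_w (W w * a n (Z w))%:E @[n --> \oo]
    --> c * \int[P]_w (h (Z w))%:E)%E.
  by under eq_fun do rewrite step.
exact: (cvg_unique _ E1 E3').
Qed.

(** Independence is given for events, that is for indicators ([k = 0]); the
induction on [k] frees the factors one at a time, each step being an instance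
of [ge0_integral_weighted] with the product of the other factors as weight. *)
Lemma expectation_prod_indep_funs (R : realType) (disp : measure_display)
    (Omega : measurableType disp) (P : probability Omega R)
    (E : nat -> set (set Omega)) (Z : nat -> Omega -> R) (n k : nat)
    (h : nat -> R -> R) :
  mutually_independent P E ->
  (forall i, measurable_fun setT (Z i)) ->
  (forall i B, measurable B -> E i (Z i @^-1` B)) ->
  (forall i, measurable_fun setT (h i)) -> (forall i z, 0 <= h i z) ->
  (forall i, (\int[P]_w (h i (Z i w))%:E)%E \is a fin_num) ->
  (forall i, (k <= i < n)%N -> exists2 A, measurable A & h i = \1_A) ->
  (\int[P]_w (\prod_(i < n) h i (Z i w))%:E =
   \prod_(i < n) \int[P]_w (h i (Z i w))%:E)%E.
Proof.
move=> indepE mZ EZ.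
have mhZ (g : R -> R) i : measurable_fun setT g ->
    measurable_fun setT (fun w => g (Z i w)).
  by move=> mg; exact: measurableT_comp.
elim: k h => [|k IHk] h mh h0 hfin hA.
  have /choice[A AP] : forall i, exists A, measurable A /\ ((i < n)%N -> h i = \1_A).
    move=> i; case: (ltnP i n) => [i_n|_]; last by exists setT.
    by have [//|A mA hE] := hA i; exists A.
  have Ih i w : (i < n)%N -> h i (Z i w) = \1_(Z i @^-1` A i) w.
    by move=> i_n; rewrite (AP i).2.
  pose J : {fset nat} := [fset i in iota 0 n]%fset.
  have JE i : (i \in J) = (i < n)%N by rewrite !inE mem_iota.
  have prodJ (S : Type) (idx : S) (op : Monoid.com_law idx) (F : nat -> S) :
      \big[op/idx]_(i <- J) F i = \big[op/idx]_(i < n) F i.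
    rewrite -(big_mkord xpredT) /index_iota subn0; apply: perm_big.
    apply: uniq_perm => [||i]; [exact: fset_uniq|exact: iota_uniq|].
    by rewrite JE mem_iota.
  have mZA i : measurable (Z i @^-1` A i).
    by rewrite -[X in measurable X]setTI; apply: mZ => //; exact: (AP i).1.
  have int_h i : (i < n)%N -> (\int[P]_w (h i (Z i w))%:E = P (Z i @^-1` A i))%E.
    move=> i_n; rewrite -[Z i @^-1` A i]setIT -integral_indic//.
    by apply: eq_integral => w _; rewrite Ih.
  under [RHS]eq_bigr => i _ do rewrite int_h//.
  rewrite -(prodJ _ _ _ (fun i => P (Z i @^-1` A i))) -indepE; last first.
    by move=> i _; apply: EZ; exact: (AP i).1.
  rewrite -[X in P X]setIT -integral_indic//; last first.
    exact: fin_bigcap_measurable.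
  apply: eq_integral => w _; congr EFin.
  rewrite -(prodJ _ _ _ (fun i => h i (Z i w))) indicE.
  have [/set_mem wA|/negP wA] := boolP (w \in _).
    rewrite big_seq big1//= => i iJ.
    by rewrite Ih -?JE// indicE mem_set//; exact: wA.
  have [i iJ wi] : exists2 i, i \in J & ~ (Z i @^-1` A i) w.
    apply/not_exists2P => H; apply: wA; apply/mem_set => i /= iJ.
    by apply: contrapT => wi; case: (H i).
  rewrite (bigD1_seq i)//= Ih -?JE// indicE memNset// mul0r//.
have mul_fin i B : measurable B ->
    (\int[P]_w (\1_B (Z i w))%:E)%E \is a fin_num.
  move=> mB; rewrite (_ : (fun w => _) = EFin \o \1_(Z i @^-1` B)) //.
  have mZB : measurable (Z i @^-1` B).
    by rewrite -[X in measurable X]setTI; exact: mZ.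
  by rewrite integral_indic// setIT fin_num_measure.
pose h' B i := if i == k then \1_B else h i.
have Eh' B : measurable B ->
  (\int[P]_w (\prod_(i < n) h' B i (Z i w))%:E =
   \prod_(i < n) \int[P]_w (h' B i (Z i w))%:E)%E.
  move=> mB; apply: IHk.
  - by move=> i; rewrite /h'; case: eqP.
  - by move=> i z; rewrite /h'; case: eqP.
  - by move=> i; rewrite /h'; case: eqP => // _; exact: mul_fin.
  - move=> i /andP[ki i_n]; rewrite /h'; case: eqP => [_|/eqP ik].
      by exists B.
    by apply: hA; rewrite ltn_neqAle eq_sym ik ki.
(* For [n <= k] the factor [k] does not occur in the products. *)
case: (ltnP k n) => [kn|nk]; last first.
  have h'E (i : 'I_n) : h' setT i = h i.
    by rewrite /h' ltn_eqF// (leq_trans _ nk).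
  have := Eh' setT measurableT.
  under eq_integral do under eq_bigr do rewrite h'E.
  by under [RHS]eq_bigr do rewrite h'E.
pose k' := Ordinal kn.
pose W w := \prod_(i < n | i != k') h i (Z i w).
pose c := (\prod_(i < n | i != k') \int[P]_w (h i (Z i w))%:E)%E.
have h'k B : h' B k = \1_B by rewrite /h' eqxx.
have h'E B (i : 'I_n) : i != k' -> h' B i = h i.
  by move=> ik; rewrite /h' ifN.
rewrite (bigD1 k')//= muleC -/c.
under eq_integral do rewrite (bigD1 k')//= mulrC -/(W _).
apply: ge0_integral_weighted => //.
- rewrite /W; under eq_fun do rewrite big_mkcond/=.
  apply: measurable_prod => i _; case: (i != k'); last exact: measurable_cst.
  exact: mhZ.
- by move=> w; apply: prodr_ge0.
- rewrite /c; elim/big_ind : _ => // x y xfin yfin; exact: fin_numM.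
move=> B mB; have := Eh' B mB.
rewrite (bigD1 k')//= h'k muleC.
under [in X in _ = X -> _]eq_bigr => i ik do rewrite (h'E B)//.
rewrite -/c => <-; apply: eq_integral => w _; congr EFin.
rewrite (bigD1 k')//= h'k mulrC; congr (_ * _).
by apply: eq_bigr => i ik; rewrite h'E.
Qed.

Lemma expectation_prod_indep (R : realType) (disp : measure_display)
    (Omega : measurableType disp) (P : probability Omega R)
    (E : nat -> set (set Omega)) (Z : nat -> Omega -> R) (n : nat) :
  mutually_independent P E ->
  (forall i, measurable_fun setT (Z i)) -> (forall i w, 0 <= Z i w) ->
  (forall i B, measurable B -> E i (Z i @^-1` B)) ->
  (forall i, (\int[P]_w (Z i w)%:E)%E \is a fin_num) ->
  (\int[P]_w (\prod_(i < n) Z i w)%:E =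
   \prod_(i < n) \int[P]_w (Z i w)%:E)%E.
Proof.
move=> indepE mZ Z0 EZ finZ.
have normZ i w : `|Z i w| = Z i w by rewrite ger0_norm.
have -> : (\prod_(i < n) \int[P]_w (Z i w)%:E =
    \prod_(i < n) \int[P]_w `|Z i w|%:E)%E.
  by apply: eq_bigr => i _; under [RHS]eq_integral do rewrite normZ.
under eq_integral do under eq_bigr do rewrite -normZ.
apply: (@expectation_prod_indep_funs _ _ _ _ E _ n n (fun=> Num.norm)) => //.
- by move=> i; under eq_integral do rewrite normZ.
- by move=> i /andP[ni]; rewrite ltnNge ni.
Qed.

(** * Exponential tails and Borel-Cantelli *)

(** Markov's inequality for the exponential of the sum, whose expectation
factorizes by independence. *)
Lemma chernoff (R : realType) (disp : measure_display)
    (Omega : measurableType disp) (P : probability Omega R)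
    (E : nat -> set (set Omega)) (U : nat -> Omega -> R) (n : nat) (b t : R) :
  mutually_independent P E ->
  (forall i, measurable_fun setT (U i)) ->
  (forall i B, measurable B -> E i (U i @^-1` B)) ->
  (forall i, (\int[P]_w (expR (U i w))%:E <= b%:E)%E) ->
  (P [set w | (t <= \sum_(i < n) U i w)%R] <= (expR (- t) * b ^+ n)%:E)%E.
Proof.
move=> indepE mU EU Ub.
have mexp i : measurable_fun setT (fun w => expR (U i w)).
  by apply: measurableT_comp => //.
have fin_exp i : (\int[P]_w (expR (U i w))%:E)%E \is a fin_num.
  rewrite ge0_fin_numE; last first.
    by apply: integral_ge0 => w _; rewrite lee_fin expR_ge0.
  by rewrite (le_lt_trans (Ub i))// ltry.
have prodE : (\int[P]_w (\prod_(i < n) expR (U i w))%:E =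
    \prod_(i < n) \int[P]_w (expR (U i w))%:E)%E.
  apply: (@expectation_prod_indep _ _ _ _ E (fun i w => expR (U i w))) => //.
  - move=> i B mB; apply: (EU i (expR @^-1` B)).
    rewrite -[X in measurable X]setTI.
    exact: measurable_expR.
have mS : measurable_fun setT (fun w => \sum_(i < n) U i w).
  exact: measurable_sum.
have mA : measurable [set w | t <= \sum_(i < n) U i w].
  rewrite (_ : [set w | _] = (fun w => \sum_(i < n) U i w) @^-1` `[t, +oo[).
    by rewrite -[X in measurable X]setTI; exact: mS.
  by apply/seteqP; split => w /=; rewrite in_itv/= andbT.
rewrite -[X in P X]setIT -integral_indic//.
apply: (@le_trans _ _
    (\int[P]_w ((expR (- t))%:E * (\prod_(i < n) expR (U i w))%:E))%E).
  apply: ge0_le_integral => //.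
  - exact/measurable_EFinP/measurable_indic.
  - apply: emeasurable_funM => //; apply/measurable_EFinP.
    exact: measurable_prod.
  - move=> w _; rewrite -EFinM lee_fin -expR_sum -expRD indicE.
    case: (boolP (w \in _)) => [|_]; last by rewrite expR_ge0.
    by rewrite inE /= => tS; rewrite -expR0 ler_expR addrC subr_ge0.
rewrite ge0_integralZl_EFin ?expR_ge0//; last 2 first.
- by move=> w _; rewrite lee_fin prodr_ge0// => i _; exact: expR_ge0.
- by apply/measurable_EFinP; exact: measurable_prod.
rewrite EFinM lee_wpmul2l ?lee_fin ?expR_ge0// prodE.
rewrite -[X in (X <= _)%E](@fineK _ (\prod_(i < n) _)%E); last first.
  by elim/big_ind : _ => // x y xfin yfin; exact: fin_numM.
have -> : (\prod_(i < n) \int[P]_w (expR (U i w))%:E =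
   (\prod_(i < n) fine (\int[P]_w (expR (U i w))%:E))%:E)%E.
  by rewrite -prodEFin; apply: eq_bigr => i _; rewrite fineK.
rewrite /= lee_fin -[in leRHS](card_ord n) -prodr_const ler_prod// => i _.
rewrite -!lee_fin fineK// Ub andbT.
by apply: integral_ge0 => w _; rewrite lee_fin expR_ge0.
Qed.

(** Borel-Cantelli for probabilities of order [n ^- 2]; the tail series is
compared to a telescoping one, since [1 / k ^ 2 <= 2 (1 / k - 1 / (k + 1))]. *)
Lemma ae_eventually_not (R : realType) (disp : measure_display)
    (Omega : measurableType disp) (P : probability Omega R)
    (A : nat -> set Omega) (c : R) (n0 : nat) :
  (forall n, measurable (A n)) -> 0 <= c ->
  (forall n, (n0 <= n)%N -> (P (A n) <= (c / n%:R ^+ 2)%:E)%E) ->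
  {ae P, forall w, exists N0, forall n, (N0 <= n)%N -> ~ A n w}.
Proof.
move=> mA c0 PA.
(* The shift avoids the index [0], where the bound is void. *)
pose B k := A (n0.+1 + k)%N.
have PB k : (P (B k) <= (2 * c * (k.+1%:R^-1 - k.+2%:R^-1))%:E)%E.
  apply: (le_trans (PA _ _)); first by rewrite addSn leqW// leq_addr.
  rewrite lee_fin.
  have k1 : 0 < k.+1%:R :> R by [].
  have k2 : k.+2%:R = k.+1%:R + 1 :> R by rewrite -natr1.
  have k1' : 1 <= k.+1%:R :> R by rewrite ler1n.
  apply: (@le_trans _ _ (c / k.+1%:R ^+ 2)).
    rewrite ler_wpM2l// lef_pV2 ?posrE ?exprn_gt0//.
    by rewrite ler_pXn2r ?nnegrE// ler_nat addSn ltnS leq_addl.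
  rewrite k2; set x : R := k.+1%:R in k1 k1' *.
  have -> : 2 * c * (x^-1 - (x + 1)^-1) = c * (2 / (x * (x + 1))).
    by field; rewrite ?gt_eqF// addr_gt0.
  rewrite ler_wpM2l// ler_pdivlMr ?mulr_gt0// ?addr_gt0//.
  rewrite (_ : _ * _ = 1 + x^-1); last by field; rewrite gt_eqF.
  by rewrite -[2]/(1 + 1) lerD2l invf_le1.
have lim0 : P (lim_sup_set B) = 0%E.
  apply: lim_sup_set_cvg0; first by move=> k; exact: mA.
  apply: (@le_lt_trans _ _ (2 * c)%:E); last exact: ltry.
  apply: lime_le; first exact: is_cvg_nneseries.
  apply: nearW => m; apply: (@le_trans _ _
      (\sum_(0 <= k < m) (2 * c * (k.+1%:R^-1 - k.+2%:R^-1))%:E)%E).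
    by apply: lee_sum => k _; exact: PB.
  rewrite sumEFin lee_fin -mulr_sumr -[leRHS]mulr1 ler_wpM2l ?mulr_ge0//.
  under eq_bigr do rewrite -opprB.
  rewrite sumrN telescope_sumr// opprB invr1 gerBl//.
exists (lim_sup_set B); split => //.
  apply: bigcapT_measurable => k; apply: bigcup_measurable => j _.
  exact: mA.
move=> w /= nev k _; apply: contrapT => nB; apply: nev.
exists (n0.+1 + k)%N => n kn An; apply: nB.
exists (n - n0.+1)%N; first by rewrite /= leq_subRL// (leq_trans _ kn)// leq_addr.
by rewrite /B subnKC// (leq_trans _ kn)// leq_addr.
Qed.

(** * Geometry of the cells *)

Definition cuts d (D : nat -> 'I_d) (j : 'I_d) (N : nat) : nat :=
  \sum_(i < N) (D i == j).

Lemma sum_cuts d (D : nat -> 'I_d) N : (\sum_(j < d) cuts D j N = N)%N.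
Proof.
rewrite /cuts exchange_big /= -[RHS]card_ord -sum1_card.
apply: eq_bigr => i _; rewrite (bigD1 (D i))//= eqxx big1// => j.
by rewrite eq_sym => /negbTE ->.
Qed.

(** A cut leaves the lower part open above, whereas a side that still touches
the face [1] of the cube is closed there: [b] records which of the two occurs.
Only the end points matter for lengths and distances. *)
Lemma tree_sides_dyadic (R : realType) d (D : nat -> 'I_d) (x : d.-tuple R) N j :
  unit_cube x -> exists lo b,
    tree_sides D x N j = Interval (BLeft lo) (BSide b (lo + 2 ^- cuts D j N)) /\
    lo <= tnth x j <= lo + 2 ^- cuts D j N.
Proof.
move=> /(_ j)/andP[x0 x1].
elim: N => [|N [lo [b [IH /andP[lox xhi]]]]] /=.
  exists 0, false; rewrite /cuts big_ord0 expr0 invr1 add0r; split => //.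
  by rewrite x0.
rewrite /cuts big_ord_recr /= -/(cuts D j N) eq_sym IH /=.
case: eqP => _; last first.
  by exists lo, b; rewrite addn0 lox xhi.
set m := _ / 2; rewrite addn1.
have mE : m = lo + 2 ^- (cuts D j N).+1.
  rewrite /m exprS invfM; field.
  by rewrite expf_neq0.
have hiE : lo + 2 ^- cuts D j N = m + 2 ^- (cuts D j N).+1.
  rewrite mE exprS invfM; field.
  by rewrite expf_neq0.
case: ltP => xm.
  by exists lo, true; rewrite -mE lox ltW.
by exists m, b; rewrite -hiE xm xhi.
Qed.

Lemma eq_tree_cell (R : realType) d (D D' : nat -> 'I_d) (x : d.-tuple R) N :
  (forall i, (i < N)%N -> D i = D' i) -> tree_cell D x N = tree_cell D' x N.
Proof.
move=> DD'; rewrite /tree_cell; suff -> : tree_sides D x N = tree_sides D' x N by [].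
elim: N DD' => [//|N IH] DD' /=.
rewrite IH; last by move=> i iN; apply: DD'; rewrite ltnW.
by rewrite DD'.
Qed.

Lemma measurable_tree_cell (R : realType) d (D : nat -> 'I_d) (x : d.-tuple R) N :
  measurable (tree_cell D x N).
Proof.
rewrite (_ : tree_cell D x N = \bigcap_(j in [set: 'I_d])
    ((fun t : d.-tuple R => tnth t j) @^-1` [set` tree_sides D x N j])).
  apply: fin_bigcap_measurable => [|j _]; first exact: finite_finset.
  rewrite -[X in measurable X]setTI.
  by apply: (measurable_tnth j) => //; exact: measurable_itv.
by apply/seteqP; split => [t It j _|t It j]; exact: It.
Qed.

(** The sides have lengths [2 ^- cuts D j N], whose exponents add up to [N]:
each step cuts exactly one side in half. *)
Lemma lebesgue_tree_cell (R : realType) d (D : nat -> 'I_d) (x : d.-tuple R) N :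
  unit_cube x -> lebesgue_tuple (tree_cell D x N) = (2 ^- N)%:E.
Proof.
move=> x01.
rewrite (lebesgue_tuple_box (I := fun j => [set` tree_sides D x N j])); last first.
  by move=> j; exact: measurable_itv.
have sideE j : lebesgue_measure [set` tree_sides D x N j] =
    (2 ^- cuts D j N)%:E :> \bar R.
  have [lo [b [-> _]]] := tree_sides_dyadic D N j x01.
  rewrite lebesgue_measure_itv /= lte_fin ltrDl invr_gt0 exprn_gt0//.
  by rewrite -EFinB addrC addKr.
under eq_bigr do rewrite sideE.
by rewrite prodEFin prodfV prodrXr sum_cuts.
Qed.

Lemma tree_cell_coord_dist (R : realType) d (D : nat -> 'I_d)
    (x y : d.-tuple R) N j :
  unit_cube x -> tree_cell D x N y -> `|tnth y j - tnth x j| <= 2 ^- cuts D j N.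
Proof.
move=> x01 /(_ j); have [lo [b [-> /andP[lox xhi]]]] := tree_sides_dyadic D N j x01.
rewrite itv_boundlr !bnd_simp => /andP[loy yhi].
have {}yhi : tnth y j <= lo + 2 ^- cuts D j N by case: b yhi => //; exact: ltW.
by rewrite ler_norml; apply/andP; split; lra.
Qed.

(** * Exponential moments on a cell *)

Lemma integral_affine_indic (R : realType) (disp : measure_display)
    (Omega : measurableType disp) (P : probability Omega R) (A : set Omega)
    (a b p : R) :
  measurable A -> P A = p%:E ->
  (\int[P]_w (a + b * \1_A w)%:E = (a + b * p)%:E)%E.
Proof.
move=> mA PA.
under eq_integral do rewrite EFinD.
rewrite integralD_EFin//; last 2 first.
- exact: finite_measure_integrable_cst.
- rewrite (_ : _ \o _ = fun w => b%:E * (\1_A w)%:E)%E//.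
  by apply: integrableZl => //; exact: integrable_indic.
have -> : (\int[P]_w a%:E = a%:E :> \bar R)%E.
  rewrite integral_cst//; have := probability_setT P => PT.
  by rewrite [X in (_ * X)%E = _]PT mule1.
have -> : (\int[P]_w (b * \1_A w)%:E = b%:E * p%:E)%E.
  under eq_integral do rewrite EFinM.
  rewrite integralZl//; last exact: integrable_indic.
  by congr (_ * _)%E; rewrite integral_indic// setIT; exact: PA.
by rewrite -EFinM -EFinD.
Qed.

Lemma same_law_integral (R : realType) (disp d' : measure_display)
    (Omega : measurableType disp) (T' : measurableType d')
    (P : probability Omega R) (U V : Omega -> T') (h : T' -> \bar R) :
  measurable_fun setT U -> measurable_fun setT V -> same_law P U V ->
  measurable_fun setT h -> (forall y, (0 <= h y)%E) ->
  (\int[P]_w h (U w) = \int[P]_w h (V w))%E.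
Proof.
move=> mU mV UV mh h0.
pose U' : {RV P >-> T'} := HB.pack U (isMeasurableFun.Build _ _ _ _ U mU).
pose V' : {RV P >-> T'} := HB.pack V (isMeasurableFun.Build _ _ _ _ V mV).
rewrite -(ge0_integral_distribution U')// -(ge0_integral_distribution V')//.
by apply: eq_measure_integral => A mA _; exact: UV.
Qed.

(** The exponential moment may be computed at [(X, Y)], where the hypotheses on
the noise live, because the copies have the same law. *)
Lemma chernoff_copies (R : realType) (disp : measure_display)
    (Omega : measurableType disp) (P : probability Omega R) d
    (X : {RV P >-> d.-tuple R}) (Y : {RV P >-> R})
    (Xs : nat -> {RV P >-> d.-tuple R}) (Ys : nat -> {RV P >-> R})
    (phi : d.-tuple R * R -> R) (n : nat) (b t : R) :
  iid_copies X Y Xs Ys -> measurable_fun setT phi ->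
  (\int[P]_w (expR (phi (X w, Y w)))%:E <= b%:E)%E ->
  (P [set w | (t <= \sum_(i < n) phi (Xs i w, Ys i w))%R]
     <= (expR (- t) * b ^+ n)%:E)%E.
Proof.
move=> [indep law] mphi phib.
have mXY (X' : {RV P >-> d.-tuple R}) (Y' : {RV P >-> R}) :
    measurable_fun setT (fun w => (X' w, Y' w)).
  exact: measurable_fun_pair.
apply: (chernoff (U := fun i w => phi (Xs i w, Ys i w)) n t indep).
- by move=> i; exact: (measurableT_comp mphi (mXY _ _)).
- move=> i B mB; exists (phi @^-1` B); last by rewrite setTI.
  by rewrite -[X in measurable X]setTI; exact: mphi.
- move=> i.
  rewrite (same_law_integral (h := fun z => (expR (phi z))%:E) (mXY _ _) (mXY X Y))//.
  by apply/measurable_EFinP; exact: measurableT_comp.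
Qed.

(** Since [expR (- u) >= 1 - u], we have [expR u <= 1 / (1 - u) <= 1 + 2 u]. *)
Lemma expR_sub1_le (R : realType) (u : R) : 0 <= u <= 2^-1 -> expR u - 1 <= 2 * u.
Proof.
move=> /andP[u0 u1].
have := expR_ge1Dx (- u); have := expRxMexpNx_1 u; have := expR_gt0 u.
move: (expR u) (expR (- u)) => a b; nra.
Qed.

(** The event [X in V] is in the sigma-algebra of [X], so the conditional
moment generating function can be integrated over it. Its version [M] is
not known to be nonnegative, hence the passage through [max M 0]. *)
Lemma cond_sub_gaussian_mgf (R : realType) (disp : measure_display)
    (Omega : measurableType disp) (P : probability Omega R) d
    (X : {RV P >-> d.-tuple R}) (sigma s : R) (eps : Omega -> R)
    (V : set (d.-tuple R)) :
  cond_sub_gaussian X sigma eps -> measurable V ->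
  (\int[P]_(w in X @^-1` V) (expR (s * eps w))%:E
     <= (expR (sigma ^+ 2 * s ^+ 2 / 2))%:E * P (X @^-1` V))%E.
Proof.
move=> [_ /(_ s)[M [[int_e int_M _ eqM] Mle]]] mV.
have mXV : measurable (X @^-1` V).
  by rewrite -[X in measurable X]setTI; exact: measurable_funPT.
rewrite eqM; last by exists V => //; rewrite setTI.
have mM : measurable_fun setT (EFin \o M) by case/integrableP: int_M.
have mMV : measurable_fun (X @^-1` V) M.
  by apply/measurable_EFinP; exact: measurable_funTS.
apply: (@le_trans _ _ (\int[P]_(w in X @^-1` V) (Num.max (M w) 0)%:E)%E).
  apply: le_integral => //.
  - exact: (integrableS _ _ _ int_M).
  - have : P.-integrable (X @^-1` V) (EFin \o M) by exact: integrableS int_M.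
    apply: le_integrable => //.
      by apply/measurable_EFinP; exact: measurable_maxr.
    move=> w _ /=; rewrite lee_fin; case: (leP (M w) 0) => M0.
      by rewrite normr0.
    by rewrite lexx.
  - by move=> w _; rewrite lee_fin le_max lexx.
rewrite -integral_cst//; apply: ae_ge0_le_integral => //.
- by move=> w _; rewrite lee_fin le_max lexx orbT.
- by apply/measurable_EFinP; exact: measurable_maxr.
- by move=> w _; rewrite lee_fin expR_ge0.
- apply: filterS Mle => w Mw _.
  by rewrite lee_fin ge_max Mw expR_ge0.
Qed.

(** On the cell, [Y - a] is the noise plus a bias of size at most [delta]; off
the cell the exponent vanishes. The moment is thus at most
[1 + q (expR u - 1)] with [u] the argument of the smallness hypothesis, which
linearizes [expR u - 1] into [2 u]. The summands are centered at a constant,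
later [g x], because only the composite of [g] with [X] is known to be
measurable. *)
Lemma cell_mgf (R : realType) (disp : measure_display)
    (Omega : measurableType disp) (P : probability Omega R) d
    (X : {RV P >-> d.-tuple R}) (Y : {RV P >-> R}) (g : d.-tuple R -> R)
    (sigma s a delta q : R) (V : set (d.-tuple R)) :
  cond_sub_gaussian X sigma (fun w => Y w - g (X w)) -> measurable V ->
  (forall w, V (X w) -> `|g (X w) - a| <= delta) ->
  P (X @^-1` V) = q%:E -> 0 <= delta ->
  sigma ^+ 2 * s ^+ 2 / 2 + `|s| * delta <= 2^-1 ->
  (\int[P]_w (expR (s * (\1_V (X w) * (Y w - a))))%:E
     <= (expR (q * (sigma ^+ 2 * s ^+ 2 + 2 * `|s| * delta)))%:E)%E.
Proof.
move=> subG mV gV PV delta0 small.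
set u := _ + _ in small.
have u0 : 0 <= u.
  by apply: addr_ge0; [rewrite divr_ge0 // -exprMn sqr_ge0|rewrite mulr_ge0].
have mXV : measurable (X @^-1` V).
  by rewrite -[X in measurable X]setTI; exact: measurable_funPT.
have q0 : 0 <= q by rewrite -lee_fin -PV.
pose eps w := Y w - g (X w).
have meps : measurable_fun setT (fun w => expR (s * eps w)).
  have [_ /(_ s)[M [[/measurable_int int_e _ _ _] _]]] := subG.
  exact/measurable_EFinP.
have mZ : measurable_fun setT (fun w => expR (s * (\1_V (X w) * (Y w - a)))).
  apply: measurableT_comp => //; apply: measurable_funM => //.
  apply: measurable_funM; last exact: measurable_funB.
  exact: (measurableT_comp (measurable_indic mV)).
have split_int : (\int[P]_w (expR (s * (\1_V (X w) * (Y w - a))))%:E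
   <= (1 - q)%:E + (expR (`|s| * delta))%:E
        * \int[P]_(w in X @^-1` V) (expR (s * eps w))%:E)%E.
  rewrite -(setvU (X @^-1` V)) ge0_integral_setU//; last 3 first.
  - exact: measurableC.
  - by apply/measurable_EFinP; exact: measurable_funTS.
  - by rewrite disj_set2E setICl.
  apply: leeD.
    under eq_integral => w.
      rewrite inE /= => nV; rewrite indicE memNset// mul0r mulr0 expR0; over.
    rewrite integral_cst ?mul1e; last exact: measurableC.
    suff -> : (1 - q)%:E = P (~` (X @^-1` V)) by [].
    by rewrite probability_setC// PV.
  rewrite -ge0_integralZl_EFin ?expR_ge0//; last first.
    by apply/measurable_EFinP; exact: measurable_funTS.
  apply: ge0_le_integral => //.
  - by apply/measurable_EFinP; exact: measurable_funTS.
  - apply: emeasurable_funM => //.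
    by apply/measurable_EFinP; exact: measurable_funTS.
  - move=> w Vw; rewrite -EFinM lee_fin -expRD ler_expR indicE mem_set// mul1r.
    have -> : Y w - a = eps w + (g (X w) - a) by rewrite /eps; ring.
    rewrite mulrDr addrC lerD2r (le_trans (ler_norm _))// normrM.
    by rewrite ler_wpM2l// gV.
apply: (le_trans split_int).
apply: (@le_trans _ _ ((1 - q)%:E + (expR u * q)%:E)%E).
  rewrite leeD2l// /u addrC expRD -mulrA EFinM lee_wpmul2l ?lee_fin ?expR_ge0//.
  by rewrite EFinM -PV; exact: cond_sub_gaussian_mgf.
rewrite -EFinD lee_fin.
apply: le_trans (expR_ge1Dx _).
have expu : expR u - 1 <= 2 * u by rewrite expR_sub1_le// u0.
have {expu} : (expR u - 1) * q <= 2 * u * q by rewrite ler_wpM2r.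
move: (expR u) => v vq.
rewrite (_ : q * _ = 2 * u * q); last by rewrite /u; field.
by rewrite (_ : 1 - q + v * q = 1 + (v - 1) * q) ?lerD2l//; ring.
Qed.

(** * Deviation of the local average on a fixed cell *)

(** Both signs of [s] are allowed, which gives the two tails. *)
Lemma cell_sum_tail (R : realType) (disp : measure_display)
    (Omega : measurableType disp) (P : probability Omega R) d
    (X : {RV P >-> d.-tuple R}) (Y : {RV P >-> R}) (g : d.-tuple R -> R)
    (Xs : nat -> {RV P >-> d.-tuple R}) (Ys : nat -> {RV P >-> R})
    (sigma s a delta q t : R) (n : nat) (V : set (d.-tuple R)) :
  iid_copies X Y Xs Ys ->
  cond_sub_gaussian X sigma (fun w => Y w - g (X w)) -> measurable V ->
  (forall w, V (X w) -> `|g (X w) - a| <= delta) ->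
  P (X @^-1` V) = q%:E -> 0 <= delta ->
  sigma ^+ 2 * s ^+ 2 / 2 + `|s| * delta <= 2^-1 ->
  (P [set w | (t <= s * (\sum_(i < n) \1_V (Xs i w) * (Ys i w - a)))%R]
     <= (expR (n%:R * (q * (sigma ^+ 2 * s ^+ 2 + 2 * `|s| * delta)) - t))%:E)%E.
Proof.
move=> iid subG mV gV PV delta0 small.
have mphi : measurable_fun setT
    (fun z : d.-tuple R * R => s * (\1_V z.1 * (z.2 - a))).
  apply: measurable_funM => //; apply: measurable_funM.
    exact: (measurableT_comp (measurable_indic mV)).
  exact: measurable_funB.
have := chernoff_copies n t iid mphi (cell_mgf subG mV gV PV delta0 small).
rewrite -expRM_natl -expRD [- t + _]addrC.
by under eq_set do rewrite -mulr_sumr.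
Qed.

(** The moment of [- 1_V (X)] is [1 - q (1 - expR (- 1)) <= expR (- q / 2)]
because [expR 1 >= 2]. *)
Lemma cell_count_tail (R : realType) (disp : measure_display)
    (Omega : measurableType disp) (P : probability Omega R) d
    (X : {RV P >-> d.-tuple R}) (Y : {RV P >-> R})
    (Xs : nat -> {RV P >-> d.-tuple R}) (Ys : nat -> {RV P >-> R})
    (q : R) (n : nat) (V : set (d.-tuple R)) :
  iid_copies X Y Xs Ys -> measurable V -> P (X @^-1` V) = q%:E ->
  (P [set w | (\sum_(i < n) \1_V (Xs i w) <= n%:R * q / 4)%R]
     <= (expR (- (n%:R * q / 4)))%:E)%E.
Proof.
move=> iid mV PV.
have mphi : measurable_fun setT (fun z : d.-tuple R * R => - \1_V z.1 : R).
  apply: measurableT_comp => //.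
  exact: (measurableT_comp (measurable_indic mV)).
have mgf : (\int[P]_w (expR (- \1_V (X w)))%:E <= (expR (- (q / 2)))%:E)%E.
  have mXV : measurable (X @^-1` V).
    by rewrite -[X in measurable X]setTI; exact: measurable_funPT.
  have q0 : 0 <= q by rewrite -lee_fin -PV.
  have e2 : expR (-1) <= 2^-1 :> R.
    rewrite expRN lef_pV2 ?posrE ?expR_gt0//.
    by rewrite -[2]/(1 + 1) expR_ge1Dx.
  apply: (@le_trans _ _ (\int[P]_w (1 + - 2^-1 * \1_(X @^-1` V) w)%:E)%E).
    apply: ge0_le_integral => //.
    - apply/measurable_EFinP; apply: measurableT_comp => //.
      apply: measurableT_comp => //.
      exact: (measurableT_comp (measurable_indic mV)).
    - apply/measurable_EFinP; apply: measurable_funD => //.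
      by apply: measurable_funM => //; exact: measurable_indic.
    - move=> w _; rewrite lee_fin !indicE.
      have -> : (w \in X @^-1` V) = (X w \in V).
        by apply/idP/idP => /set_mem/= ?; exact/mem_set.
      case: (_ \in _) => /=; last by rewrite oppr0 expR0 mulr0 addr0.
      by rewrite mulr1 (le_trans e2)//; lra.
  rewrite (integral_affine_indic _ _ mXV PV) lee_fin.
  by rewrite mulNr; apply: le_trans (expR_ge1Dx _); rewrite mulrC.
have := chernoff_copies n (- (n%:R * q / 4)) iid mphi mgf.
rewrite -expRM_natl -expRD opprK.
under eq_set do rewrite sumrN lerN2.
by rewrite (_ : _ + _ = - (n%:R * q / 4)) //; field.
Qed.

Lemma local_average_error (R : realType) d (V : set (d.-tuple R))
    (xs : nat -> d.-tuple R) (ys : nat -> R) (n : nat) (a c t : R) :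
  0 < c -> 0 <= t -> c <= \sum_(i < n) \1_V (xs i) ->
  `|\sum_(i < n) \1_V (xs i) * (ys i - a)| <= t ->
  `|local_average V xs ys n - a| <= t / c.
Proof.
move=> c0 t0; set S := \sum_(i < n) \1_V (xs i) => cS tS.
have S0 : 0 < S by exact: lt_le_trans cS.
have -> : local_average V xs ys n - a =
    (\sum_(i < n) \1_V (xs i) * (ys i - a)) / S.
  rewrite /local_average -/S -{1}(mulfK (lt0r_neq0 S0) a) -mulrBl.
  congr (_ / _); rewrite [a * S]mulrC /S mulr_suml -sumrB.
  by apply: eq_bigr => i _; ring.
rewrite normrM normfV (gtr0_norm S0).
apply: (@le_trans _ _ (t / S)); first by rewrite ler_wpM2r// invr_ge0 ltW.
by rewrite ler_wpM2l// lef_pV2 ?posrE.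
Qed.

(** With [s = r] or [s = - r] in [cell_sum_tail], the normalization
[n q r ^ 2 = ln n] makes the threshold [tau = n q (2 delta + B r)] exceeded
with probability at most [expR ((sigma ^ 2 - B) ln n)] on each side. Dividing
[tau] by the count [n q / 4] gives the stated error. *)
Lemma cell_deviation (R : realType) (disp : measure_display)
    (Omega : measurableType disp) (P : probability Omega R) d
    (X : {RV P >-> d.-tuple R}) (Y : {RV P >-> R}) (g : d.-tuple R -> R)
    (Xs : nat -> {RV P >-> d.-tuple R}) (Ys : nat -> {RV P >-> R})
    (sigma B r a delta q : R) (n : nat) (V : set (d.-tuple R)) :
  iid_copies X Y Xs Ys ->
  cond_sub_gaussian X sigma (fun w => Y w - g (X w)) -> measurable V ->
  (forall w, V (X w) -> `|g (X w) - a| <= delta) ->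
  P (X @^-1` V) = q%:E -> 0 <= delta -> 0 < n%:R * q ->
  0 <= B -> 0 <= r -> n%:R * q * r ^+ 2 = ln n%:R ->
  sigma ^+ 2 * r ^+ 2 / 2 + r * delta <= 2^-1 ->
  exists A, [/\ measurable A,
    (P A <= (expR (- (n%:R * q / 4))
              + 2 * expR ((sigma ^+ 2 - B) * ln n%:R))%:E)%E &
    forall w, ~ A w ->
      `|local_average V (Xs ^~ w) (Ys ^~ w) n - a| <= 8 * delta + 4 * B * r].
Proof.
move=> iid subG mV gV PV delta0 nq0 B0 r0 nqr small.
have m1 i : measurable_fun setT (fun w => \1_V (Xs i w) : R).
  exact: (measurableT_comp (measurable_indic mV)).
pose S w : R := \sum_(i < n) \1_V (Xs i w).
pose T w := \sum_(i < n) \1_V (Xs i w) * (Ys i w - a).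
have mS : measurable_fun setT S by exact: measurable_sum.
have mT : measurable_fun setT T.
  apply: measurable_sum => i; apply: measurable_funM; first exact: m1.
  exact: measurable_funB.
pose tau := n%:R * q * (2 * delta + B * r).
have tail s : `|s| = r -> (P [set w | (r * tau <= s * T w)%R]
    <= (expR ((sigma ^+ 2 - B) * ln n%:R))%:E)%E.
  move=> sr; have s2 : s ^+ 2 = r ^+ 2 by rewrite -sr real_normK ?num_real.
  apply: (le_trans (cell_sum_tail _ _ iid subG mV gV PV delta0 _)).
    by rewrite s2 sr.
  rewrite lee_fin ler_expR s2 sr -nqr /tau le_eqVlt; apply/orP; left.
  by apply/eqP; ring.
pose A0 := [set w | S w <= n%:R * q / 4].
pose A1 := [set w | r * tau <= r * T w].
pose A2 := [set w | r * tau <= - r * T w].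
have mle (f h : Omega -> R) : measurable_fun setT f -> measurable_fun setT h ->
    measurable [set w | f w <= h w].
  move=> mf mh; rewrite (_ : [set w | _] = (fun w => f w <= h w) @^-1` [set true]).
    rewrite -[X in measurable X]setTI.
    exact: (measurable_fun_ler mf mh).
  by apply/seteqP; split.
have mA0 : measurable A0 by exact: mle.
have mA1 : measurable A1 by apply: mle => //; exact: measurable_funM.
have mA2 : measurable A2 by apply: mle => //; exact: measurable_funM.
have mA12 : measurable (A1 `|` A2) by exact: measurableU.
exists (A0 `|` (A1 `|` A2)); split.
- exact: measurableU.
- apply: (le_trans (measureU2 _ _ _)) => //.
  rewrite EFinD; apply: leeD; first exact: (cell_count_tail n iid mV PV).
  apply: (le_trans (measureU2 _ _ _)) => //.
  rewrite mulr2n mulrDl !mul1r EFinD; apply: leeD; apply: tail.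
    by rewrite ger0_norm.
  by rewrite normrN ger0_norm.
- move=> w /not_orP[/negP]; rewrite -ltNge => Sw /not_orP[/negP + /negP].
  rewrite -!ltNge => T1 T2.
  have {T1 T2} Tw : `|T w| <= tau.
    have [r0E|r_neq0] := eqVneq r 0.
      by move: T1; rewrite r0E !mul0r ltxx.
    have r_gt0 : 0 < r by rewrite lt_neqAle eq_sym r_neq0.
    rewrite ler_norml; apply/andP; split; apply/ltW; last first.
      by move: T1; rewrite ltr_pM2l.
    by rewrite ltrNl; move: T2; rewrite mulNr -mulrN ltr_pM2l.
  have -> : 8 * delta + 4 * B * r = tau / (n%:R * q / 4).
    have := lt0r_neq0 nq0; rewrite mulf_eq0 negb_or => /andP[n_neq0 q_neq0].
    by rewrite /tau; field; rewrite q_neq0.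
  apply: local_average_error => //.
  + by rewrite divr_gt0.
  + by apply: mulr_ge0; [exact: ltW|rewrite addr_ge0 ?mulr_ge0].
  + exact: ltW.
Qed.

(** * Balance of the directions *)

Lemma finite_union_bound (R : realType) (disp : measure_display)
    (Omega : measurableType disp) (P : probability Omega R) (I : finType)
    (A : I -> set Omega) (c : R) :
  (forall i, measurable (A i)) -> (forall i, (P (A i) <= c%:E)%E) ->
  exists U, [/\ measurable U, (P U <= (#|I|%:R * c)%:E)%E &
    forall i, A i `<=` U].
Proof.
move=> mA PA.
pose U (s : seq I) := \big[setU/set0]_(i <- s) A i.
have US s : measurable (U s) /\ (P (U s) <= ((size s)%:R * c)%:E)%E.
  rewrite /U; elim: s => [|i s [mU PU]].
    by rewrite big_nil measure0 mul0r; split.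
  rewrite big_cons; split; first exact: measurableU.
  apply: (le_trans (measureU2 _ _ _)) => //.
  by rewrite /= -natr1 mulrDl mul1r addrC EFinD; exact: leeD.
exists (U (enum I)); have [mU PU] := US (enum I); split => //.
  by rewrite cardT.
by move=> i; rewrite /U (bigD1_seq i) ?mem_enum ?enum_uniq//= => w; left.
Qed.

(** From [expR (- s) <= 1 / (1 + s)] and [(1 - s + s ^ 2) (1 + s) = 1 + s ^ 3]. *)
Lemma expRN_le_quadratic (R : realType) (s : R) :
  0 <= s -> expR (- s) <= 1 - s + s ^+ 2.
Proof.
move=> s0.
have := expR_ge1Dx s; have := expRxMexpNx_1 s; have := expR_gt0 (- s).
move: (expR s) (expR (- s)) => a b b0 ab1 sa.
have : b * (1 + s) <= (1 - s + s ^+ 2) * (1 + s).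
  apply: (@le_trans _ _ (1 : R)).
    by rewrite -[X in _ <= X]ab1 [a * b]mulrC ler_wpM2l// ltW.
  rewrite (_ : _ * _ = 1 + s ^+ 3); last by ring.
  by rewrite lerDl exprn_ge0.
by rewrite ler_pM2r//; lra.
Qed.

(** Chernoff bound for the lower tail of a binomial variable; the quadratic
bound on [expR (- s)] makes it valid for every [s >= 0]. *)
Lemma cuts_tail (R : realType) (disp : measure_display)
    (Omega : measurableType disp) (P : probability Omega R) d
    (D : nat -> Omega -> 'I_d) (j : 'I_d) (N : nat) (s t : R) :
  iid_uniform P D -> 0 <= s ->
  exists A, [/\ measurable A,
    (P A <= (expR (N%:R / d%:R * s ^+ 2 - s * t))%:E)%E &
    forall w, (cuts (D ^~ w) j N)%:R <= N%:R / d%:R - t :> R -> A w].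
Proof.
move=> [mD indep PD] s0.
pose U i w : R := - (s * \1_(D i @^-1` [set j]) w).
have mU i : measurable_fun setT (U i).
  by apply: measurableT_comp => //; exact: measurable_funM.
have p0 : 0 <= d%:R^-1 :> R by rewrite invr_ge0.
have mgf i : (\int[P]_w (expR (U i w))%:E
    <= (expR (d%:R^-1 * (s ^+ 2 - s)))%:E)%E.
  have expU w : expR (U i w)
      <= 1 + (s ^+ 2 - s) * \1_(D i @^-1` [set j]) w.
    rewrite /U indicE; case: (_ \in _) => /=; last by rewrite !mulr0 oppr0 expR0 addr0.
    by rewrite !mulr1 (le_trans (expRN_le_quadratic s0))//; lra.
  have mDj : measurable (D i @^-1` [set j]) by exact: mD.
  apply: (@le_trans _ _ (\int[P]_w
      (1 + (s ^+ 2 - s) * \1_(D i @^-1` [set j]) w)%:E)%E).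
    apply: ge0_le_integral => //.
    - by apply/measurable_EFinP; exact: measurableT_comp.
    - apply/measurable_EFinP; apply: measurable_funD => //.
      exact: measurable_funM.
    - by move=> w _; rewrite lee_fin.
  rewrite (integral_affine_indic _ _ mDj (PD i j)) lee_fin.
  by apply: le_trans (expR_ge1Dx _); rewrite mulrC.
pose A := [set w | (- (s * (N%:R / d%:R - t)) <= \sum_(i < N) U i w)%R].
exists A; split.
- rewrite (_ : A = (fun w => \sum_(i < N) U i w)
      @^-1` `[- (s * (N%:R / d%:R - t)), +oo[).
    rewrite -[X in measurable X]setTI.
    by have : measurable_fun setT (fun w => \sum_(i < N) U i w);
      [exact: measurable_sum|exact].
  by apply/seteqP; split => w /=; rewrite in_itv/= andbT.
- apply: (le_trans (chernoff N (- (s * (N%:R / d%:R - t))) indep mU _ mgf)).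
    move=> i B mB.
    (* Every set of directions is an event of the discrete sigma-algebra. *)
    exists [set k | B (- (s * \1_[set j] k))] => //.
    by rewrite setTI; apply/seteqP; split.
  rewrite -expRM_natl -expRD lee_fin ler_expR le_eqVlt; apply/orP; left.
  apply/eqP; ring.
- move=> w cw; rewrite /A /= /U sumrN lerN2 -mulr_sumr ler_wpM2l//.
  apply: le_trans cw; rewrite /cuts natr_sum le_eqVlt; apply/orP; left; apply/eqP.
  apply: eq_bigr => i _; rewrite indicE; congr (nat_of_bool _)%:R.
  by apply/idP/eqP => [/set_mem//|Dj]; apply/mem_set.
Qed.

(** The optimal [s = t / (2 N / d)] in [cuts_tail] gives the exponent
[- t ^ 2 / (4 N / d)], which is [- 2 ln N] for the chosen deviation [t]; a
union over the [d] directions leaves the summable bound [d / N ^ 2]. *)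
Lemma tree_balanced (R : realType) (disp : measure_display)
    (Omega : measurableType disp) (P : probability Omega R) d
    (D : nat -> Omega -> 'I_d) :
  (0 < d)%N -> iid_uniform P D ->
  {ae P, forall w, exists N0, forall N, (N0 <= N)%N -> forall j,
    N%:R / d%:R - Num.sqrt (8 * (N%:R / d%:R) * ln N%:R)
      < (cuts (D ^~ w) j N)%:R :> R}.
Proof.
move=> d0 iidD.
pose t N : R := Num.sqrt (8 * (N%:R / d%:R) * ln N%:R).
have step N : exists A, [/\ measurable A,
    (0 < N)%N -> (P A <= (d%:R / N%:R ^+ 2)%:E)%E &
    forall w j, (cuts (D ^~ w) j N)%:R <= N%:R / d%:R - t N -> A w].
  have [->|N0] := posnP N; first by exists setT; split.
  pose a : R := N%:R / d%:R.
  have a0 : 0 < a by rewrite divr_gt0 ?ltr0n.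
  have l0 : 0 <= ln N%:R :> R by rewrite ln_ge0// ler1n.
  (* The minimizer of [a * s ^+ 2 - s * t N]. *)
  pose s : R := t N / (2 * a).
  have s0 : 0 <= s by rewrite divr_ge0 ?sqrtr_ge0// mulr_ge0// ltW.
  have t2 : t N ^+ 2 = 8 * a * ln N%:R by rewrite sqr_sqrtr// !mulr_ge0// ltW.
  have sE : a * s ^+ 2 - s * t N = - (2 * ln N%:R).
    rewrite (_ : _ - _ = - (t N ^+ 2 / (4 * a))); last first.
      by rewrite /s; field; rewrite gt_eqF.
    by rewrite t2; field; rewrite gt_eqF.
  have /choice[A AP] := fun j => cuts_tail j N (t N) iidD s0.
  have mA j : measurable (A j) by case: (AP j).
  have PA j : (P (A j) <= ((N%:R ^+ 2)^-1)%:E)%E.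
    case: (AP j) => _ + _; rewrite -/a sE.
    by rewrite expRN mulrC expRM_natr lnK// posrE ltr0n.
  have [U [mU PU AU]] := finite_union_bound mA PA.
  exists U; split => // [_|w j cw].
    by rewrite -[in X in (_ <= X)%E](card_ord d).
  by apply: (AU j); case: (AP j) => _ _; apply.
have [A AP] := choice step.
have := @ae_eventually_not R _ _ P A d%:R 1%N.
have mA N : measurable (A N) by case: (AP N).
move=> /(_ mA (ler0n _ _)) [|B [mB PB AB]].
  by move=> N N1; case: (AP N) => _ + _; apply.
exists B; split => // w /= nw; apply: AB => /= -[N0 HN0]; apply: nw.
exists N0 => N NN0 j; rewrite ltNge; apply/negP => cw.
by apply: (HN0 N NN0); case: (AP N) => _ _; apply; exact: cw.
Qed.

(** * Rates *)

Lemma ln2_bounds (R : realType) : 2^-1 <= ln (2 : R) <= 1.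
Proof.
apply/andP; split; last first.
  by rewrite -[X in ln X]/(1 + 1); apply: le_ln1Dx; lra.
have : ln (1 + (- 2^-1)) <= - 2^-1 :> R by apply: le_ln1Dx; lra.
rewrite (_ : 1 + - 2^-1 = 2^-1 :> R); last by field.
by rewrite lnV ?posrE// lerN2.
Qed.

Lemma pow2_expR (R : realType) (k : nat) : 2 ^- k = expR (- (k%:R * ln 2)) :> R.
Proof. by rewrite expRN expRM_natl lnK ?posrE. Qed.

Lemma tree_steps_bounds (R : realType) (d n : nat) : (1 <= n)%N ->
  (tree_steps R d n)%:R * ((d%:R + 2) * ln 2) <= d%:R * ln n%:R :> R /\
  d%:R * ln n%:R < (tree_steps R d n).+1%:R * ((d%:R + 2) * ln 2) :> R.
Proof.
move=> n1; have /andP[ln2_gt _] := ln2_bounds R.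
have den : 0 < (d%:R + 2) * ln 2 :> R by rewrite mulr_gt0 ?ltr_wpDl//; lra.
have l0 : 0 <= ln n%:R :> R by rewrite ln_ge0// ler1n.
split.
  rewrite -ler_pdivlMr//; rewrite truncn_le.
  by apply: divr_ge0; [exact: mulr_ge0|exact: ltW].
by rewrite -ltr_pdivrMr//; exact: truncnS_gt.
Qed.

Lemma tree_steps_le (R : realType) (d n : nat) : (1 <= n)%N ->
  (tree_steps R d n)%:R <= 2 * ln n%:R :> R.
Proof.
move=> n1; have [+ _] := tree_steps_bounds R d n1.
have l0 : 0 <= ln n%:R :> R by rewrite ln_ge0// ler1n.
have /andP[] := ln2_bounds R.
have := ler0n R d; have := ler0n R (tree_steps R d n).
move: (tree_steps R d n)%:R (d%:R) (ln 2) (ln n%:R) l0 => N e c l l0 N0 e0 c1 c2 H.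
have : N * ((e + 2) * 2^-1) <= e * l.
  by apply: le_trans H; rewrite ler_wpM2l// ler_wpM2l//; lra.
nra.
Qed.

(** The expected number of points in a cell of depth [N] is, up to a constant,
at least [n ^ (2 / (d + 2))]. *)
Lemma cell_mass_lower (R : realType) (d n : nat) : (1 <= n)%N ->
  expR (2 * (ln n%:R / (d%:R + 2))) <= n%:R * 2 ^- tree_steps R d n :> R.
Proof.
move=> n1; have [H _] := tree_steps_bounds R d n1.
rewrite -{2}[n%:R]lnK ?posrE ?ltr0n// pow2_expR -expRD ler_expR.
have d2 : 0 < d%:R + 2 :> R by rewrite ltr_wpDl.
rewrite -(ler_pM2r d2) (_ : 2 * _ * _ = 2 * ln n%:R); last first.
  by field; rewrite gt_eqF.
move: H; set N := (tree_steps _ _ _)%:R; lra.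
Qed.

Lemma expR_ge_sqr (R : realType) (y : R) : 0 <= y -> y ^+ 2 <= expR (2 * y).
Proof.
move=> y0; rewrite expRM_natl ler_pXn2r ?nnegrE ?expR_ge0//.
by apply: le_trans (expR_ge1Dx y); rewrite lerDr.
Qed.

(** After squaring this reads
[(ln 2) ^ 2 * 8 (N / d) ln N <= 4 l ln l] with [l = ln n]. It follows from
[(N / d) ln 2 <= l / (d + 2) <= l / 3] and from [N <= 2 l], which gives
[ln N <= ln l + 1]; the slack between [8 / 3] and [4] covers the [+ 1] as soon
as [ln l >= 2]. *)
Lemma tree_steps_log (R : realType) (d n : nat) : (1 <= n)%N -> (0 < d)%N ->
  2 <= ln (ln n%:R) :> R ->
  ln 2 * Num.sqrt (8 * ((tree_steps R d n)%:R / d%:R) * ln (tree_steps R d n)%:R)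
    <= 2 * Num.sqrt (ln n%:R * ln (ln n%:R)) :> R.
Proof.
move=> n1 d0 ll2; have [H _] := tree_steps_bounds R d n1.
have HN := tree_steps_le R d n1.
set N := tree_steps R d n in H HN *.
have l0 : 0 < ln n%:R :> R.
  rewrite lt_neqAle ln_ge0 ?ler1n// andbT eq_sym; apply/eqP => l0.
  by move: ll2; rewrite l0 ln0// leNgt ltr0n.
have /andP[ln2_ge ln2_le] := ln2_bounds R.
have lnN : ln N%:R <= ln (ln n%:R) + 1 :> R.
  have [->|N0] := posnP N; first by rewrite ln0//; lra.
  apply: (@le_trans _ _ (ln (2 * ln n%:R))).
    by rewrite ler_ln ?posrE ?mulr_gt0// ltr0n.
  by rewrite lnM ?posrE// addrC lerD2l.
have lnN0 : 0 <= ln N%:R :> R.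
  have [->|N0] := posnP N; first by rewrite ln0.
  by rewrite ln_ge0// ler1n.
have d0' : 0 < d%:R :> R by rewrite ltr0n.
have scale_sqrt (a x : R) : 0 <= a -> a * Num.sqrt x = Num.sqrt (a ^+ 2 * x).
  by move=> a0; rewrite sqrtrM ?sqr_ge0// sqrtr_sqr ger0_norm.
rewrite !scale_sqrt//; last lra.
rewrite ler_wsqrtr//.
have Nd : N%:R / d%:R * ln 2 <= ln n%:R / 3 :> R.
  rewrite mulrAC ler_pdivrMr//.
  have : N%:R * ln 2 * 3 <= d%:R * ln n%:R :> R.
    apply: le_trans H; rewrite -mulrA [ln 2 * 3]mulrC ler_wpM2l//.
    have d1 : 1 <= d%:R :> R by rewrite ler1n.
    by rewrite ler_wpM2r//; lra.
  lra.
apply: (@le_trans _ _ (8 * (ln n%:R / 3) * (ln (ln n%:R) + 1))).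
  rewrite [X in X <= _](_ : _ =
    8 * (N%:R / d%:R * ln 2) * (ln 2 * ln N%:R)); last by ring.
  apply: ler_pM.
  - by rewrite !mulr_ge0//; lra.
  - by rewrite mulr_ge0//; lra.
  - by rewrite ler_wpM2l.
  - by rewrite (le_trans _ lnN)// ler_piMl.
rewrite [X in X <= _](_ : _ = ln n%:R * (8 / 3 * (ln (ln n%:R) + 1))); last by field.
rewrite [X in _ <= X](_ : _ = ln n%:R * (4 * ln (ln n%:R))); last by ring.
by apply: ler_wpM2l; [exact: ltW|lra].
Qed.

(** Rounding the depth down to an integer loses at most one step, hence the
factor [2]. *)
Lemma side_rate (R : realType) (d n k : nat) : (1 <= n)%N -> (0 < d)%N ->
  2 <= ln (ln n%:R) :> R ->
  (tree_steps R d n)%:R / d%:R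
     - Num.sqrt (8 * ((tree_steps R d n)%:R / d%:R) * ln (tree_steps R d n)%:R)
    < k%:R :> R ->
  2 ^- k <= 2 * n%:R `^ (- (1 / (d%:R + 2)))
    * expR (2 * Num.sqrt (ln n%:R * ln (ln n%:R))) :> R.
Proof.
move=> n1 d0 ll2 kN; have [_ H] := tree_steps_bounds R d n1.
have TL := tree_steps_log n1 d0 ll2.
have /andP[ln2_ge ln2_le] := ln2_bounds R.
have d0' : 0 < d%:R :> R by rewrite ltr0n.
have d1 : 1 <= d%:R :> R by rewrite ler1n.
set N := tree_steps R d n in H kN TL *.
set t := Num.sqrt (8 * _ * _) in kN TL.
have Nd : ln n%:R / (d%:R + 2) - ln 2 <= N%:R / d%:R * ln 2 :> R.
  have : ln n%:R / (d%:R + 2) <= (N%:R + 1) / d%:R * ln 2 :> R.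
    rewrite ler_pdivrMr; last lra.
    rewrite [X in _ <= X](_ : _ = N.+1%:R * ((d%:R + 2) * ln 2) / d%:R).
      by rewrite ler_pdivlMr// mulrC ltW.
    by rewrite -natr1; field; rewrite gt_eqF.
  move=> h; have : ln 2 / d%:R <= ln 2 :> R by rewrite ler_pdivrMr// ler_peMr//; lra.
  move: h; rewrite mulrDl mulrDl mul1r [d%:R^-1 * _]mulrC; lra.
rewrite pow2_expR /powR pnatr_eq0 gtn_eqF//.
rewrite -[X in X * expR _ * _]lnK ?posrE// -!expRD ler_expR.
have : (N%:R / d%:R - t) * ln 2 <= k%:R * ln 2 :> R.
  by apply: ler_wpM2r; [lra|exact: ltW].
rewrite mulrBl [t * _]mulrC mul1r mulNr [_^-1 * _]mulrC; lra.
Qed.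

(** Here [sqrt l = expR (ln l / 2)] and [ln l <= sqrt (l ln l)]. *)
Lemma sqrt_ln_le (R : realType) (l : R) : 1 <= l ->
  Num.sqrt l <= expR (2 * Num.sqrt (l * ln l)).
Proof.
move=> l1; have l0 : 0 < l by lra.
have ll0 : 0 <= ln l by rewrite ln_ge0.
have : ln l <= Num.sqrt (l * ln l).
  rewrite -{1}[ln l]ger0_norm// -sqrtr_sqr ler_wsqrtr// expr2 ler_wpM2r//.
  exact/ltW/ln_sublinear.
rewrite -(powR12_sqrt (ltW l0)) {1}/powR gt_eqF// ler_expR; lra.
Qed.

(** * Cells of the tree *)

Lemma sqrt_sum_sqr_le (R : realType) d (u v : 'I_d -> R) :
  (forall j, `|u j| <= v j) -> Num.sqrt (\sum_(j < d) u j ^+ 2) <= \sum_(j < d) v j.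
Proof.
move=> uv.
have v0 j : 0 <= v j by exact: le_trans (uv j).
have S0 : 0 <= \sum_(j < d) v j by exact: sumr_ge0.
rewrite -[X in _ <= X]ger0_norm// -sqrtr_sqr ler_wsqrtr//.
rewrite expr2 mulr_suml; apply: ler_sum => j _.
rewrite -real_normK ?num_real// expr2 ler_pM//.
by apply: (le_trans (uv j)); rewrite (bigD1 j)//= lerDl sumr_ge0.
Qed.

Lemma tree_cell_lipschitz (R : realType) d (D : nat -> 'I_d)
    (x y : d.-tuple R) (g : d.-tuple R -> R) L N :
  euclidean_lipschitz (@unit_cube R d) L g -> unit_cube x -> unit_cube y ->
  tree_cell D x N y -> `|g y - g x| <= `|L| * \sum_(j < d) 2 ^- cuts D j N.
Proof.
move=> lip x01 y01 Vy; apply: (le_trans (lip _ _ y01 x01)).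
apply: (@le_trans _ _ (`|L| * Num.sqrt (\sum_(j < d) (tnth y j - tnth x j) ^+ 2))).
  by rewrite ler_wpM2r ?sqrtr_ge0 ?ler_norm.
rewrite ler_wpM2l//; apply: sqrt_sum_sqr_le => j.
exact: tree_cell_coord_dist.
Qed.

(** The case [r = sqrt (l / (n q))] of [cell_deviation] for a cell with the mass
inequality, where [n q >= m expR (2 l / (d + 2)) >= m l ^ 2 / (d + 2) ^ 2]. The
last two hypotheses say that [l] is large: the first gives [r <= r0], so that
the smallness condition holds uniformly in the cell, and the second makes the
tail of the count as small as the tail of the sum. *)
Lemma tree_cell_deviation (R : realType) (disp : measure_display)
    (Omega : measurableType disp) (P : probability Omega R) d
    (X : {RV P >-> d.-tuple R}) (Y : {RV P >-> R}) (g : d.-tuple R -> R)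
    (Xs : nat -> {RV P >-> d.-tuple R}) (Ys : nat -> {RV P >-> R})
    (sigma L m r0 : R) (x : d.-tuple R) (D : nat -> 'I_d) (n : nat) :
  let l := ln n%:R in
  let N := tree_steps R d n in
  let B := sigma ^+ 2 + 2 * d%:R + 2 in
  (forall w, unit_cube (X w)) -> iid_copies X Y Xs Ys ->
  cond_sub_gaussian X sigma (fun w => Y w - g (X w)) ->
  euclidean_lipschitz (@unit_cube R d) L g -> unit_cube x ->
  (1 <= n)%N -> 0 < l -> 0 < m -> 0 < r0 ->
  ((m * 2 ^- N)%:E <= P (X @^-1` tree_cell D x N))%E ->
  sigma ^+ 2 * r0 ^+ 2 / 2 + r0 * (`|L| * d%:R) <= 2^-1 ->
  (d%:R + 2) ^+ 2 <= m * l * r0 ^+ 2 ->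
  4 * (2 * d%:R + 2) * (d%:R + 2) ^+ 2 <= m * l ->
  exists A, [/\ measurable A,
    (P A <= (3 * expR (- ((2 * d%:R + 2) * l)))%:E)%E &
    forall w, ~ A w ->
      `|local_average (tree_cell D x N) (Xs ^~ w) (Ys ^~ w) n - g x|
      <= 8 * (`|L| * \sum_(j < d) 2 ^- cuts D j N)
         + 4 * B / Num.sqrt m * (Num.sqrt l * n%:R `^ (- (1 / (d%:R + 2))))].
Proof.
move=> l N B X01 iid subG lip x01 n1 l0 m0 r0_gt0 mass small c1 c2.
set V := tree_cell D x N in mass *.
have mV : measurable V by exact: measurable_tree_cell.
pose q := fine (P (X @^-1` V)).
have PV : P (X @^-1` V) = q%:E.
  rewrite fineK// fin_num_measure// -[X in measurable X]setTI.
  exact: measurable_funPT.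
have d2 : 0 < d%:R + 2 :> R by rewrite ltr_wpDl.
pose e := expR (2 * (l / (d%:R + 2))).
have nq_e : m * e <= n%:R * q.
  have : m * 2 ^- N <= q by rewrite -lee_fin -PV.
  have := cell_mass_lower R d n1; rewrite -/l -/N -/e => en mq.
  apply: (@le_trans _ _ (m * (n%:R * 2 ^- N))); first by rewrite ler_wpM2l// ltW.
  by rewrite mulrCA ler_wpM2l.
have e_sqr : l ^+ 2 <= e * (d%:R + 2) ^+ 2.
  rewrite -ler_pdivrMr ?exprn_gt0// -expr_div_n.
  by apply: expR_ge_sqr; rewrite divr_ge0// ltW.
have e0 : 0 < e by exact: expR_gt0.
have nq0 : 0 < n%:R * q by apply: lt_le_trans nq_e; rewrite mulr_gt0.
pose r := Num.sqrt (l / (n%:R * q)).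
have r_ge0 : 0 <= r by exact: sqrtr_ge0.
have r2 : r ^+ 2 = l / (n%:R * q) by rewrite sqr_sqrtr// divr_ge0// ltW.
have r_r0 : r <= r0.
  rewrite -(ler_pXn2r (ltn0Sn 1)) ?nnegrE ?(ltW r0_gt0)// r2 ler_pdivrMr//.
  apply: (@le_trans _ _ (r0 ^+ 2 * (m * e))); last by rewrite ler_wpM2l ?sqr_ge0.
  rewrite -(ler_pM2r l0) -expr2 (le_trans e_sqr)//.
  apply: (@le_trans _ _ (e * (m * l * r0 ^+ 2))); first by rewrite ler_pM2l.
  by rewrite le_eqVlt; apply/orP; left; apply/eqP; ring.
pose delta := `|L| * \sum_(j < d) 2 ^- cuts D j N.
have delta0 : 0 <= delta by rewrite mulr_ge0// sumr_ge0.
have delta_d : delta <= `|L| * d%:R.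
  rewrite ler_wpM2l// -[X in _ <= X%:R]card_ord -sumr_const ler_sum// => j _.
  by rewrite invf_le1 ?exprn_gt0// exprn_ege1// ler1n.
have B0 : 0 <= B by rewrite !addr_ge0 ?sqr_ge0 ?mulr_ge0.
have small' : sigma ^+ 2 * r ^+ 2 / 2 + r * delta <= 2^-1.
  apply: le_trans small; apply: lerD; last exact: ler_pM.
  rewrite ler_wpM2r// ler_wpM2l ?sqr_ge0// ler_pXn2r ?nnegrE//.
  exact: ltW.
have gV w : V (X w) -> `|g (X w) - g x| <= delta.
  by move=> Vw; exact: tree_cell_lipschitz.
have nqr : n%:R * q * r ^+ 2 = ln n%:R.
  by rewrite r2 mulrCA mulfV ?mulr1// gt_eqF.
have [A [mA PA HA]] := cell_deviation iid subG mV gV PV delta0 nq0 B0 r_ge0 nqr small'.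
exists A; split => //.
  apply: (le_trans PA); rewrite lee_fin.
  rewrite [X in _ <= X](_ : _ = expR (- ((2 * d%:R + 2) * l))
    + 2 * expR (- ((2 * d%:R + 2) * l))); last by ring.
  apply: lerD; last first.
    by rewrite ler_wpM2l// ler_expR -/l /B le_eqVlt; apply/orP; left; apply/eqP; ring.
  rewrite ler_expR lerN2 ler_pdivlMr//.
  apply: le_trans nq_e.
  have d22 : 0 < (d%:R + 2) ^+ 2 :> R by rewrite exprn_gt0.
  rewrite -(ler_pM2r d22) -[X in _ <= X]mulrA.
  apply: (@le_trans _ _ (m * l * l)).
    rewrite [X in X <= _](_ : _ =
      4 * (2 * d%:R + 2) * (d%:R + 2) ^+ 2 * l); last by ring.
    by rewrite ler_pM2r.
  by rewrite -mulrA -expr2 ler_pM2l.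
move=> w /HA; rewrite -/delta => /le_trans; apply; rewrite lerD2l.
have -> : 4 * B / Num.sqrt m * (Num.sqrt l * n%:R `^ (- (1 / (d%:R + 2))))
    = 4 * B * ((Num.sqrt m)^-1 * (Num.sqrt l * n%:R `^ (- (1 / (d%:R + 2))))).
  by rewrite !mulrA.
rewrite ler_wpM2l ?mulr_ge0//.
rewrite -(ler_pXn2r (ltn0Sn 1)) ?nnegrE//.
rewrite r2 !exprMn exprVn (sqr_sqrtr (ltW m0)) (sqr_sqrtr (ltW l0)).
have -> : (n%:R `^ (- (1 / (d%:R + 2)))) ^+ 2 = e^-1.
  rewrite /powR pnatr_eq0 gtn_eqF// -expRM_natl /e -expRN; congr expR.
  by rewrite -/l; field; rewrite gt_eqF.
have -> : m^-1 * (l * e^-1) = l / (m * e) by rewrite mulrCA -invfM.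
apply: ler_wpM2l; first exact: ltW.
by rewrite lef_pV2 ?posrE//; exact: mulr_gt0.
Qed.

(** * Almost sure rate *)

(** A single exceptional event serves all direction sequences: the value
[2 d + 2] in the exponent beats their number [d ^ N <= expR (2 d l)] by
[expR (- 2 l) = n ^- 2]. Sequences without the mass inequality contribute
the empty event. *)
Lemma tree_deviation (R : realType) (disp : measure_display)
    (Omega : measurableType disp) (P : probability Omega R) d
    (X : {RV P >-> d.-tuple R}) (Y : {RV P >-> R}) (g : d.-tuple R -> R)
    (Xs : nat -> {RV P >-> d.-tuple R}) (Ys : nat -> {RV P >-> R})
    (sigma L m r0 : R) (x : d.-tuple R) (n : nat) :
  let l := ln n%:R in
  let N := tree_steps R d n in
  let B := sigma ^+ 2 + 2 * d%:R + 2 in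
  (0 < d)%N -> (forall w, unit_cube (X w)) -> iid_copies X Y Xs Ys ->
  cond_sub_gaussian X sigma (fun w => Y w - g (X w)) ->
  euclidean_lipschitz (@unit_cube R d) L g -> unit_cube x ->
  (1 <= n)%N -> 0 < l -> 0 < m -> 0 < r0 ->
  sigma ^+ 2 * r0 ^+ 2 / 2 + r0 * (`|L| * d%:R) <= 2^-1 ->
  (d%:R + 2) ^+ 2 <= m * l * r0 ^+ 2 ->
  4 * (2 * d%:R + 2) * (d%:R + 2) ^+ 2 <= m * l ->
  exists A, [/\ measurable A, (P A <= (3 / n%:R ^+ 2)%:E)%E &
    forall w D, ~ A w ->
      ((m * 2 ^- N)%:E <= P (X @^-1` tree_cell D x N))%E ->
      `|local_average (tree_cell D x N) (Xs ^~ w) (Ys ^~ w) n - g x|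
      <= 8 * (`|L| * \sum_(j < d) 2 ^- cuts D j N)
         + 4 * B / Num.sqrt m * (Num.sqrt l * n%:R `^ (- (1 / (d%:R + 2))))].
Proof.
move=> l N B d0 X01 iid subG lip x01 n1 l0 m0 r0_gt0 small c1 c2.
pose j0 := Ordinal d0.
pose c := 3 * expR (- ((2 * d%:R + 2) * l)).
have cell (s : N.-tuple 'I_d) : exists A, [/\ measurable A, (P A <= c%:E)%E &
    forall w, ~ A w -> let D := nth j0 s in
      ((m * 2 ^- N)%:E <= P (X @^-1` tree_cell D x N))%E ->
      `|local_average (tree_cell D x N) (Xs ^~ w) (Ys ^~ w) n - g x|
      <= 8 * (`|L| * \sum_(j < d) 2 ^- cuts D j N)
         + 4 * B / Num.sqrt m * (Num.sqrt l * n%:R `^ (- (1 / (d%:R + 2))))].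
  case: (boolP ((m * 2 ^- N)%:E <= P (X @^-1` tree_cell (nth j0 s) x N))%E).
    move=> mass.
    have [A [mA PA HA]] := tree_cell_deviation X01 iid subG lip x01 n1 l0 m0
      r0_gt0 mass small c1 c2.
    by exists A; split => // w /HA.
  move=> /negP nmass; exists set0; split => //.
  by rewrite measure0 lee_fin mulr_ge0 ?expR_ge0.
have [A AP] := choice cell.
have [U [mU PU AU]] := finite_union_bound (c := c)
  (fun s => let: And3 h _ _ := AP s in h)
  (fun s => let: And3 _ h _ := AP s in h).
exists U; split => //.
  apply: (le_trans PU); rewrite lee_fin card_tuple card_ord.
  have dN : (d ^ N)%:R <= expR (2 * d%:R * l) :> R.
    rewrite natrX -[2 * _ * _]mulrA [d%:R * l]mulrC mulrA.
    apply: (@le_trans _ _ (expR (N%:R * d%:R))).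
      rewrite expRM_natl lerXn2r ?nnegrE ?expR_ge0//.
      by apply: le_trans (expR_ge1Dx _); rewrite lerDr.
    by rewrite ler_expR ler_wpM2r//; exact: tree_steps_le.
  apply: (@le_trans _ _ (expR (2 * d%:R * l) * c)).
    by rewrite ler_wpM2r// mulr_ge0 ?expR_ge0.
  rewrite /c mulrCA -expRD ler_wpM2l//.
  have -> : 2 * d%:R * l + - ((2 * d%:R + 2) * l) = - (2 * l) by ring.
  by rewrite expRN expRM_natl lnK// posrE ltr0n.
move=> w D nU mass.
(* The cell only depends on the first [N] directions. *)
pose s := [tuple D i | i < N].
have DE i : (i < N)%N -> nth j0 s i = D i.
  by move=> iN; rewrite -(tnth_nth _ _ (Ordinal iN)) tnth_mktuple.
have cellE : tree_cell (nth j0 s) x N = tree_cell D x N by exact: eq_tree_cell.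
have cutsE j : cuts (nth j0 s) j N = cuts D j N.
  by apply: eq_bigr => i _; rewrite DE.
have [_ _ /(_ w)] := AP s.
rewrite /= cellE; under eq_bigr do rewrite cutsE.
by apply => // As; apply: nU; exact: AU As.
Qed.

Lemma ln_nat_unbounded (R : realType) (M : R) :
  exists n0, (1 <= n0)%N /\ forall n, (n0 <= n)%N -> M <= ln n%:R.
Proof.
exists (Num.truncn (expR M)).+1; split => // n Hn.
rewrite -[M]expRK ler_ln ?posrE ?expR_gt0//; last by rewrite ltr0n (leq_trans _ Hn).
by rewrite (le_trans (ltW (truncnS_gt _)))// ler_nat.
Qed.

Theorem corollary25 (R : realType) (d : nat) (sigma kappa fx L : R) :
  (1 <= d)%N -> 0 < kappa -> 0 < fx ->
  exists C : R, 0 < C /\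
    forall (disp : measure_display) (Omega : measurableType disp)
      (P : probability Omega R)
      (X : {RV P >-> d.-tuple R}) (Y : {RV P >-> R})
      (g f : d.-tuple R -> R)
      (Xs : nat -> {RV P >-> d.-tuple R}) (Ys : nat -> {RV P >-> R})
      (D : nat -> Omega -> 'I_d) (x : d.-tuple R),
      (forall w, unit_cube (X w)) ->
      is_regression X Y g ->
      iid_copies X Y Xs Ys ->
      iid_uniform P D ->
      independent_of_data D Xs Ys ->
      cond_sub_gaussian X sigma (fun w => Y w - g (X w)) ->
      minimal_mass X D kappa f ->
      euclidean_lipschitz (@unit_cube R d) L g ->
      unit_cube x -> f x = fx ->
      {ae P, forall w, exists N0 : nat, forall n : nat, (N0 <= n)%N ->
        `|local_average (tree_cell (D ^~ w) x (tree_steps R d n))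
            (Xs ^~ w) (Ys ^~ w) n - g x|
        <= C * n%:R `^ (- (1 / (d%:R + 2)))
             * expR (2 * Num.sqrt (ln n%:R * ln (ln n%:R)))}.
Proof.
move=> d0 kappa0 fx0.
pose m := kappa * fx.
pose B := sigma ^+ 2 + 2 * d%:R + 2.
have m0 : 0 < m by rewrite mulr_gt0.
have B0 : 0 < B by rewrite ltr_wpDl// addr_ge0 ?sqr_ge0 ?mulr_ge0.
have Ld0 : 0 <= `|L| * d%:R by rewrite mulr_ge0.
(* Bias [8 |L| d] times the factor [2] of [side_rate], plus the noise term of
   [tree_deviation]. *)
exists (16 * (`|L| * d%:R) + 4 * B / Num.sqrt m); split.
  by rewrite ltr_wpDl// ?mulr_ge0// divr_gt0 ?sqrtr_gt0// mulr_gt0.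
move=> disp Omega P X Y g f Xs Ys D x X01 _ iid iidD _ subG [_ mass] lip x01 fxE.
(* With this [r0 <= 1], both terms of [small] are at most [r0] times their
   coefficient. *)
pose r0 := (2 * (sigma ^+ 2 + `|L| * d%:R + 1))^-1.
have den0 : 0 < sigma ^+ 2 + `|L| * d%:R + 1.
  by rewrite ltr_wpDl// addr_ge0// sqr_ge0.
have r0_gt0 : 0 < r0 by rewrite invr_gt0 mulr_gt0.
have small : sigma ^+ 2 * r0 ^+ 2 / 2 + r0 * (`|L| * d%:R) <= 2^-1.
  have r0_le : r0 <= 1.
    rewrite invf_le1 ?mulr_gt0//.
    have : 0 <= sigma ^+ 2 + `|L| * d%:R by rewrite addr_ge0 ?sqr_ge0.
    lra.
  have r0E : r0 * (sigma ^+ 2 + `|L| * d%:R + 1) = 2^-1.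
    by rewrite /r0; field; rewrite gt_eqF.
  have s2 : 0 <= sigma ^+ 2 by rewrite sqr_ge0.
  have : sigma ^+ 2 * (r0 * r0) <= sigma ^+ 2 * r0.
    by rewrite ler_wpM2l// -[X in _ <= X]mulr1 ler_wpM2l// ltW.
  rewrite -expr2; have : 0 <= sigma ^+ 2 * r0 ^+ 2 by rewrite mulr_ge0 ?sqr_ge0.
  lra.
(* [M1], [M2] and [expR 2] are the sizes of [ln n] required by
   [tree_deviation] and [side_rate]. *)
pose M1 := (d%:R + 2) ^+ 2 / (m * r0 ^+ 2).
pose M2 := 4 * (2 * d%:R + 2) * (d%:R + 2) ^+ 2 / m.
have [n0 [n0_ge1 ln_n0]] := ln_nat_unbounded (expR 2 + M1 + M2).
have M10 : 0 <= M1 by rewrite divr_ge0 ?mulr_ge0 ?sqr_ge0// ltW.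
have M20 : 0 <= M2.
  by apply: divr_ge0; [rewrite !mulr_ge0 ?addr_ge0 ?sqr_ge0 ?mulr_ge0|exact: ltW].
have big n : (n0 <= n)%N -> [/\ (1 <= n)%N, expR 2 <= ln n%:R :> R,
    (d%:R + 2) ^+ 2 <= m * ln n%:R * r0 ^+ 2 &
    4 * (2 * d%:R + 2) * (d%:R + 2) ^+ 2 <= m * ln n%:R].
  move=> nn0; have := ln_n0 n nn0; have e2 := expR_gt0 (2 : R) => Hl.
  split; first exact: leq_trans nn0.
  - lra.
  - rewrite mulrAC -ler_pdivrMl ?mulr_gt0 ?exprn_gt0// mulrC -/M1; lra.
  - rewrite -ler_pdivrMl// mulrC -/M2; lra.
have dev n : exists A, [/\ measurable A,
    (n0 <= n)%N -> (P A <= (3 / n%:R ^+ 2)%:E)%E &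
    (n0 <= n)%N -> forall w D, ~ A w ->
      ((m * 2 ^- tree_steps R d n)%:E
        <= P (X @^-1` tree_cell D x (tree_steps R d n)))%E ->
      `|local_average (tree_cell D x (tree_steps R d n)) (Xs ^~ w) (Ys ^~ w) n - g x|
      <= 8 * (`|L| * \sum_(j < d) 2 ^- cuts D j (tree_steps R d n))
         + 4 * B / Num.sqrt m
           * (Num.sqrt (ln n%:R) * n%:R `^ (- (1 / (d%:R + 2))))].
  have [nn0|nn0] := leqP n0 n; last by exists set0; split.
  have [n1 l2 c1 c2] := big n nn0.
  have l0 : 0 < ln n%:R :> R by apply: lt_le_trans l2; exact: expR_gt0.
  have [A [mA PA HA]] := tree_deviation d0 X01 iid subG lip x01 n1 l0 m0
    r0_gt0 small c1 c2.
  by exists A; split.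
have [A AP] := choice dev.
have ev := @ae_eventually_not R _ _ P A 3 n0
  (fun n => let: And3 h _ _ := AP n in h) (ler0n _ 3)
  (fun n => let: And3 _ h _ := AP n in h).
have bal := tree_balanced d0 iidD.
apply: filterS3 ev bal mass => w [N1 nA] [N2 balanced] mass.
(* Since [N.+1 > ln n / 3], this forces [N2 <= N]. *)
have [n1 [_ ln_n1]] := ln_nat_unbounded (3 * (N2%:R + 1) : R).
exists (maxn n0 (maxn N1 n1)) => n; rewrite !geq_max => /and3P[nn0 nN1 nn1].
have [n_ge1 l2 _ _] := big n nn0.
have l0 : 0 < ln n%:R :> R by apply: lt_le_trans l2; exact: expR_gt0.
have ll2 : 2 <= ln (ln n%:R) :> R.
  by rewrite -[2]expRK ler_ln ?posrE ?expR_gt0.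
set N := tree_steps R d n.
have NN2 : (N2 <= N)%N.
  have [_ H] := tree_steps_bounds R d n_ge1.
  have /andP[ln2_ge ln2_le] := ln2_bounds R.
  have d1 : 1 <= d%:R :> R by rewrite ler1n.
  have : d%:R * (3 * N2.+1%:R) < N.+1%:R * (3 * d%:R) :> R.
    apply: (le_lt_trans _ (lt_le_trans H _)).
      by rewrite ler_wpM2l// -[N2.+1%:R]natr1; exact: ln_n1.
    apply: ler_wpM2l => //; rewrite -[X in _ <= X]mulr1.
    by apply: ler_pM => //; lra.
  rewrite (_ : d%:R * _ = N2.+1%:R * (3 * d%:R)); last by ring.
  have d3 : 0 < 3 * d%:R :> R by rewrite mulr_gt0 ?ltr0n.
  by rewrite (ltr_pM2r d3) ltr_nat ltnS => /ltnW.
have massN : ((m * 2 ^- N)%:E <= P (X @^-1` tree_cell (D ^~ w) x N))%E.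
  by have := mass x N x01; rewrite lebesgue_tree_cell// fxE.
have [_ _ /(_ nn0 w (D ^~ w) (nA n nN1) massN) err] := AP n.
apply: (le_trans err).
pose p := n%:R `^ (- (1 / (d%:R + 2))) : R.
pose E := expR (2 * Num.sqrt (ln n%:R * ln (ln n%:R))) : R.
have p0 : 0 <= p by exact: powR_ge0.
have E0 : 0 <= E by exact: expR_ge0.
rewrite -/p -/E (_ : _ * p * E = 16 * (`|L| * d%:R) * (p * E)
  + 4 * B / Num.sqrt m * (p * E)); last by ring.
apply: lerD.
  rewrite (_ : 16 * _ * _ = 8 * (`|L| * (d%:R * (2 * p * E)))); last by ring.
  apply: ler_wpM2l => //; apply: ler_wpM2l => //.
  rewrite mulr_natl -[X in _ <= _ *+ X]card_ord -sumr_const ler_sum// => j _.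
  by apply: side_rate => //; exact: balanced.
rewrite ler_wpM2l ?divr_ge0 ?mulr_ge0 ?sqrtr_ge0 ?(ltW B0)// mulrC ler_wpM2l//.
by apply: sqrt_ln_le; apply: le_trans l2; rewrite -expR0 ler_expR.
Qed.
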